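(* Let $p\in(0,1]$ and let $(A,\|\cdot\|)$ be a complex uniform $p$-normed $*$-algebra with unit such that every element of $H(A)$ has a real spectrum in the completion $B$ of $A$, i.e. $Sp_B(h)\subset\mathbb{R}$ for all $h\in H(A)$. Then $B$ is a commutative $C^*$-algebra, when equipped with the norm $\|\cdot\|^{1/p}$ and the continuous extension to $B$ of the involution of $A$.
   Context: Algebras are associative and not assumed commutative. For $p\in(0,1]$, a $p$-homogeneous norm on a complex algebra $A$ is a map $\|\cdot\|:A\to[0,\infty)$ with $\|a+b\|\le\|a\|+\|b\|$, $\|\alpha a\|=|\alpha|^p\|a\|$ ($\alpha\in\mathbb{C}$), and $\|a\|=0$ only if $a=0$. A $p$-normed algebra is an algebra with a submultiplicative ($\|ab\|\le\|a\|\|b\|$) $p$-homogeneous norm; it is uniform if $\|a^2\|=\|a\|^2$ for all $a$. The completion $B$ of $(A,\|\cdot\|)$ carries the extended $p$-norm, again denoted $\|\cdot\|$. A $*$-algebra is a complex algebra with a map $a\mapsto a^*$ satisfying $(a^* )^*=a$, $(a+b)^*=a^*+b^*$, $(\alpha a)^*=\bar\alpha a^*$, $(ab)^*=b^*a^*$ (no continuity or compatibility with $\|\cdot\|$ is assumed). $H(A)=\{a\in A: a^*=a\}$. For a complex algebra $B$ with unit $e$, $Sp_B(b)=\{\alpha\in\mathbb{C}:\alpha e-b\notin B^{-1}\}$, where $B^{-1}$ is the set of invertible elements of $B$. *)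

(* Defs.v *)
From HB Require Import structures.
From mathcomp Require Import all_boot all_order all_algebra.
From mathcomp Require Import all_classical all_reals all_analysis.
From mathcomp Require Export complex.

Set Implicit Arguments.
Unset Strict Implicit.
Unset Printing Implicit Defensive.

Import Order.TTheory GRing.Theory Num.Theory.
Import numFieldTopology.Exports.

Local Open Scope classical_set_scope.
Local Open Scope ring_scope.

(* Norms are explicit real-valued functions: the normed structures of the
   library are homogeneous of degree 1, which excludes p < 1. *)

Definition p_norm (R : realType) (A : lmodType R[i]) (p : R) (nrm : A -> R) :=
  [/\ forall a, 0 <= nrm a,
      forall a b, nrm (a + b) <= nrm a + nrm b,
      forall (alpha : R[i]) a, nrm (alpha *: a) = (Normc.normc alpha `^ p) * nrm a &
      forall a, nrm a = 0 -> a = 0].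

Definition p_normed_algebra (R : realType) (A : algType R[i]) (p : R)
    (nrm : A -> R) :=
  p_norm p nrm /\ forall a b, nrm (a * b) <= nrm a * nrm b.

Definition uniform_norm (R : realType) (A : algType R[i]) (nrm : A -> R) :=
  forall a, nrm (a ^+ 2) = nrm a ^+ 2.

Definition complete_norm (R : realType) (V : zmodType) (nrm : V -> R) :=
  forall u : nat -> V,
    (forall e : R, 0 < e -> \forall m & n \near \oo, nrm (u m - u n) < e) ->
    exists l : V, (fun n => nrm (u n - l)) @ \oo --> (0 : R).

Definition continuous_norm (R : realType) (V : zmodType) (nrm : V -> R)
    (f : V -> V) :=
  forall a (e : R), 0 < e -> exists2 d : R, 0 < d &
    forall b, nrm (b - a) < d -> nrm (f b - f a) < e.

(* The completion is described up to isometric isomorphism: a complete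
   p-normed algebra with a norm-preserving unital algebra morphism of dense
   range from A. *)
Definition completion (R : realType) (p : R) (A B : algType R[i])
    (nrmA : A -> R) (nrmB : B -> R) (iota : {lrmorphism A -> B}) :=
  [/\ p_normed_algebra p nrmB,
      complete_norm nrmB,
      forall a, nrmB (iota a) = nrmA a &
      forall b (e : R), 0 < e -> exists a, nrmB (b - iota a) < e].

Definition star_involution (R : realType) (A : algType R[i]) (star : A -> A) :=
  [/\ forall a, star (star a) = a,
      forall a b, star (a + b) = star a + star b,
      forall (alpha : R[i]) a, star (alpha *: a) = (alpha^*)%R *: star a &
      forall a b, star (a * b) = star b * star a].

Definition self_adjoint (R : realType) (A : algType R[i]) (star : A -> A) : set A :=
  [set a | star a = a].

Definition invertible (B : nzRingType) (b : B) :=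
  exists c, b * c = 1 /\ c * b = 1.

Definition spectrum (R : realType) (B : algType R[i]) (b : B) : set R[i] :=
  [set alpha | ~ invertible (alpha%:A - b)].

Definition cstar_algebra (R : realType) (B : algType R[i]) (nrm : B -> R)
    (star : B -> B) :=
  [/\ p_normed_algebra 1 nrm,
      complete_norm nrm,
      star_involution star &
      forall b, nrm (star b * b) = nrm b ^+ 2].

Definition continuous_extension (R : realType) (A B : algType R[i])
    (nrmB : B -> R) (iota : A -> B) (starA : A -> A) (starB : B -> B) :=
  continuous_norm nrmB starB /\ forall a, starB (iota a) = iota (starA a).

(* Main.v *)
Require Import Defs.
From HB Require Import structures.
From mathcomp Require Import all_boot all_order all_algebra.
From mathcomp Require Import all_classical all_reals all_analysis.
From mathcomp Require Import ring lra zify.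

Set Implicit Arguments.
Unset Strict Implicit.
Unset Printing Implicit Defensive.

Import Order.TTheory GRing.Theory Num.Theory.
Import numFieldTopology.Exports.
Import Normc.

Local Open Scope classical_set_scope.
Local Open Scope ring_scope.

(** The algebra A is dense in B, so the norm of B is uniform as well, and it
    remains to see that B is commutative, that the p-th root of its norm is
    subadditive, and that the involution of A is isometric and satisfies the
    C*-identity.  For p < 1 the space B need not have any nonzero continuous
    functional, so the arguments use only the norm and the resolvents.

    Commutativity (uniform_commutative).  Since (x y)^(n+1) = x (y x)^n y and
    the norm of a 2^k-th power is the 2^k-th power of the norm, |x y| = |y x|.
    Therefore (1 + la)^n b (1 - la)^n has the norm of b (1 - l^2 a^2)^n, which
    stays below 2 |b| as long as n |l|^2 is small.  With z = n l this says that
    an approximation of exp(za) b exp(-za) is bounded on the circle of radius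
    about n^(1/2).  Its z^j coefficient tends to ad_a^j(b) / j!, and Cauchy's
    estimate, which for p < 1 loses only a power of n that does not depend on
    j, forces ad_a^j(b) = 0 for large j.  By the theorem of Kleinecke and
    Shirokov, ad_a(ad_a(c)) = 0 makes ad_a(c) quasi-nilpotent, hence zero for a
    uniform norm; descending in j gives ad_a(b) = 0.

    Subadditivity (root_normD).  For commuting a and b the binomial formula
    bounds |(a + b)^n| by (n + 1) (|a|^(1/p) + |b|^(1/p))^(pn); take n-th roots
    along n = 2^k.  From here on N = |.|^(1/p) is a complete uniform norm.

    Spectrum (spectral_point).  Some spectral point of b has modulus N b.
    Otherwise, if N b = 1, the resolvent is bounded on the unit circle, and
    averaging it over square roots carries the bound to all the powers b^(2^k)
    without loss; comparison with a slightly smaller circle, where the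
    resolvents of high powers are close to 1, shows that b^(2^k) tends to 0.

    The C*-identity (spectrum_hermitian_le, norm_hermitian_le).  For an element
    with real spectrum, having nonnegative spectrum is a norm condition, and so
    it is preserved by sums.  Let h, k be self-adjoint, G = h^2 + k^2 and
    x + iy in the spectrum of h + ik; put M = x^2 + y^2, u = xh + yk and
    j = xk - yh, so that u^2 + j^2 = M G.  If M > N G, then u^2 <= M N(G) < M^2
    bounds (M - u)^2 + j^2 away from 0; but this element is a multiple of
    (x + iy) - (h + ik), which is not invertible.  Hence N(a)^2 <= N(a^* a) for
    a = h + ik in A.  It follows that the involution is isometric and that
    equality holds, and both pass to B by continuity. *)

(** * Real estimates *)

Lemma natr_le_pow2 (R : realType) (x : R) :
  exists k0 : nat, forall k, (k0 <= k)%N -> x < (2 ^ k)%:R.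
Proof.
exists (Num.Def.archi_bound `|x|) => k hk.
apply: (le_lt_trans (ler_norm x)).
apply: (lt_trans (archi_boundP (normr_ge0 x))).
by rewrite ltr_nat (leq_ltn_trans hk) // ltn_expl.
Qed.

Lemma bernoulli_ineq (R : realType) (d : R) (n : nat) :
  0 <= d -> 1 + n%:R * d <= (1 + d) ^+ n.
Proof.
move=> d0; elim: n => [|n IH]; first by rewrite mul0r addr0 expr0.
rewrite exprS; apply: le_trans (_ : (1 + d) * (1 + n%:R * d) <= _).
  rewrite -natr1; have : 0 <= n%:R * d * d by rewrite !mulr_ge0.
  lra.
by apply: ler_wpM2l => //; lra.
Qed.

(** Extracting roots of order 2^k removes a constant and a factor linear in the
    exponent.  Only these exponents occur, since a uniform norm determines the
    norm of a power only along them. *)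
Lemma le_of_pow2_growth (R : realType) (s t c : R) : 0 <= t ->
  (forall k, s ^+ (2 ^ k) <= c * (2 ^ k).+1%:R * t ^+ (2 ^ k)) -> s <= t.
Proof.
move=> t0 H; rewrite leNgt; apply/negP => ts.
have tpos : 0 < t.
  rewrite lt_neqAle t0 andbT; apply/eqP => t00.
  have := H 0%N; rewrite expn0 !expr1 -t00 mulr0; lra.
pose d := s / t - 1.
have dpos : 0 < d by rewrite subr_gt0 ltr_pdivlMr ?mul1r.
have sE : s = t * (1 + d) by rewrite /d; field; rewrite gt_eqF.
have G k : (1 + (2 ^ k)%:R * d) ^+ 2 <= c * (2 ^ k.+1).+1%:R.
  have := H k.+1; rewrite sE exprMn mulrC ler_pM2r ?exprn_gt0 // => h.
  apply: le_trans h; rewrite (_ : (2 ^ k.+1 = (2 ^ k) * 2)%N); last by rewrite expnS mulnC.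
  rewrite exprM lerXn2r // ?nnegrE ?bernoulli_ineq ?exprn_ge0 //; try lra.
  by have := mulr_ge0 (ler0n R (2 ^ k)) (ltW dpos); lra.
have c0 : 0 <= c.
  have := G 0%N; have := sqr_ge0 (1 + (2 ^ 0)%:R * d).
  by move=> h1 h2; have := le_trans h1 h2; rewrite pmulr_lge0.
have [k0 hk] := natr_le_pow2 (3 * c / d ^+ 2).
have := G k0; have := hk _ (leqnn _); rewrite ltr_pdivrMr ?exprn_gt0 //.
rewrite -(natr1 (2 ^ k0.+1)) expnS natrM; set n : R := (2 ^ k0)%:R.
have n1 : 1 <= n by rewrite ler1n expn_gt0.
move=> h1 h2.
have h3 : n * (3 * c) < n * (n * d ^+ 2) by rewrite ltr_pM2l; lra.
have h4 : 0 <= n * d by rewrite mulr_ge0 //; lra.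
have h5 : c <= c * n by rewrite ler_peMr.
nra.
Qed.

Lemma cvg_powR0 (R : realType) (p : R) (u : nat -> R) : 0 < p ->
  u @ \oo --> 0 -> (fun n => `|u n| `^ p) @ \oo --> (0 : R).
Proof.
move=> p0 /cvgrPdist_lt h; apply/cvgrPdist_lt => e e0.
have d0 : 0 < e `^ p^-1 by rewrite powR_gt0.
near=> n; rewrite sub0r normrN ger0_norm ?powR_ge0 //.
have hn : `|u n| < e `^ p^-1.
  by have : `|0 - u n| < e `^ p^-1 by [near: n; exact: h]; rewrite sub0r normrN.
have -> : e = (e `^ p^-1) `^ p by rewrite -powRrM mulVf ?gt_eqF // powRr1 // ltW.
by apply: gt0_ltr_powR; rewrite ?nnegrE ?powR_ge0.
Unshelve. all: by end_near.
Qed.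

(** The coefficients of (1 + z/n)^n tend to those of exp z. *)
Lemma cvg_bin_ratio (R : realType) (i : nat) :
  (fun n => 'C(n, i)%:R / n%:R ^+ i) @ \oo --> (i`!%:R^-1 : R).
Proof.
elim: i => [|i IH].
  rewrite (_ : (fun _ => _) = fun=> (1 : R)).
    by rewrite fact0 invr1; exact: cvg_cst.
  by apply/funext => n; rewrite bin0 expr0 invr1 mulr1.
have -> : (i.+1`!%:R^-1 : R) = i`!%:R^-1 * ((1 - i%:R * 0) / i.+1%:R).
  by rewrite factS natrM invfM mulr0 subr0 mul1r mulrC.
have inv0 : (fun n : nat => n%:R^-1 : R) @ \oo --> (0 : R).
  apply: (iffRL (gtr0_cvgV0 _)); last exact: cvgr_idn.
  by near=> n; rewrite ltr0n; near: n; exact: nbhs_infty_gt.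
apply: (@cvg_trans _ ((fun n => ('C(n, i)%:R / n%:R ^+ i) *
   ((1 - i%:R * n%:R^-1) / i.+1%:R) : R) @ \oo)); last first.
  apply: cvgM => //; apply: cvgMr_tmp; apply: cvgB; first exact: cvg_cst.
  exact: cvgMl_tmp.
apply: near_eq_cvg; near=> n.
have ni : (i.+1 <= n)%N by near: n; exact: nbhs_infty_ge.
have n0 : n%:R != 0 :> R by rewrite pnatr_eq0; lia.
have hb : 'C(n, i.+1)%:R * i.+1%:R = (n%:R - i%:R) * 'C(n, i)%:R :> R.
  by rewrite -natrB ?(ltnW ni) // -!natrM -mul_bin_left mulnC.
have -> : 'C(n, i.+1)%:R = (n%:R - i%:R) * 'C(n, i)%:R / i.+1%:R :> R.
  by rewrite -hb mulfK // pnatr_eq0.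
rewrite exprS; field.
by rewrite expf_neq0 // n0 addrC natr1 pnatr_eq0.
Unshelve. all: by end_near.
Qed.

Lemma powRXn (R : realType) (x p : R) n : 0 <= x -> (x ^+ n) `^ p = (x `^ p) ^+ n.
Proof.
move=> x0; elim: n => [|n IH]; first by rewrite !expr0 powR1.
by rewrite !exprS powRM ?exprn_ge0 // IH.
Qed.

Lemma bin_le_expn n i : ('C(n, i) <= n ^ i)%N.
Proof.
elim: i => [|i IH]; first by rewrite bin0.
apply: (leq_trans (leq_pmull _ (ltn0Sn i))).
by rewrite mul_bin_left expnS leq_mul // leq_subr.
Qed.

(** * The modulus of a complex number *)

Lemma normc_ge0 (R : rcfType) (z : R[i]) : 0 <= normc z.
Proof. by case: z => a b; exact: sqrtr_ge0. Qed.

Lemma normcX (R : rcfType) (z : R[i]) n : normc (z ^+ n) = normc z ^+ n.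
Proof. by elim: n => [|n IH]; rewrite ?expr0 ?normc1 // !exprS normcM IH. Qed.

Lemma normc_opp (R : rcfType) (z : R[i]) : normc (- z) = normc z.
Proof. exact: (normcN (z : Rcomplex R)). Qed.

Lemma normc_real (R : rcfType) (x : R) : normc x%:C%C = `|x|.
Proof. by rewrite /= expr0n addr0 sqrtr_sqr. Qed.

Lemma normc_nat (R : rcfType) n : normc (n%:R : R[i]) = n%:R.
Proof. by rewrite -(rmorph_nat (real_complex R)) normc_real normr_nat. Qed.

Lemma normc_sqrtc (R : rcfType) (z : R[i]) : normc z = 1 -> normc (sqrtc z) = 1.
Proof.
move=> z1; have := congr1 (@normc R) (sqr_sqrtc z); rewrite normcX z1 => h.
by apply/eqP; rewrite -(eqrXn2 (n := 2)) ?normc_ge0 // expr1n h.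
Qed.

Lemma normc_le_ReIm (R : rcfType) (x y : R) : normc (x +i* y)%C <= `|x| + `|y|.
Proof.
rewrite /= -(ger0_norm (addr_ge0 (normr_ge0 x) (normr_ge0 y))) -sqrtr_sqr.
rewrite ler_wsqrtr // sqrrD !real_normK ?num_real //.
by have := mulr_ge0 (normr_ge0 x) (normr_ge0 y); lra.
Qed.

(** * p-normed algebras *)

Section PNorm.
Variables (R : realType) (B : algType R[i]) (p : R) (nrm : B -> R).
Hypothesis p0 : 0 < p.
Hypothesis nrmP : p_normed_algebra p nrm.

Lemma pnorm_ge0 x : 0 <= nrm x.
Proof. by case: nrmP => -[h _ _ _] _; exact: h. Qed.

Lemma pnormD x y : nrm (x + y) <= nrm x + nrm y.
Proof. by case: nrmP => -[_ h _ _] _; exact: h. Qed.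

Lemma pnormZ (l : R[i]) x : nrm (l *: x) = normc l `^ p * nrm x.
Proof. by case: nrmP => -[_ _ h _] _; exact: h. Qed.

Lemma pnorm_eq0 x : nrm x = 0 -> x = 0.
Proof. by case: nrmP => -[_ _ _ h] _; exact: h. Qed.

Lemma pnormM x y : nrm (x * y) <= nrm x * nrm y.
Proof. by case: nrmP => _ h; exact: h. Qed.

Lemma pnorm0 : nrm 0 = 0.
Proof. by rewrite -(scale0r (0 : B)) pnormZ normc0 powR0 ?mul0r // gt_eqF. Qed.

Lemma pnormN x : nrm (- x) = nrm x.
Proof.
by rewrite -scaleN1r pnormZ (normcN (1 : Rcomplex R)) normc1 powR1 mul1r.
Qed.

Lemma pnormB x y : nrm (x - y) <= nrm x + nrm y.
Proof. by rewrite -(pnormN y) pnormD. Qed.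

Lemma pdistC x y : nrm (x - y) = nrm (y - x).
Proof. by rewrite -pnormN opprB. Qed.

Lemma pdist_triangle z x y : nrm (x - y) <= nrm (x - z) + nrm (z - y).
Proof. by have := pnormD (x - z) (z - y); rewrite addrA subrK. Qed.

Lemma ler_pdist x y : `|nrm x - nrm y| <= nrm (x - y).
Proof.
rewrite ler_norml; apply/andP; split.
  by have := pnormD (y - x) x; rewrite subrK pdistC; lra.
by have := pnormD (x - y) y; rewrite subrK; lra.
Qed.

Lemma pnorm_sum (I : Type) (r : seq I) (P : pred I) (F : I -> B) :
  nrm (\sum_(i <- r | P i) F i) <= \sum_(i <- r | P i) nrm (F i).
Proof.
elim/big_ind2: _ => //; first by rewrite pnorm0.
by move=> x1 y1 x2 y2 h1 h2; apply: le_trans (pnormD _ _) (lerD h1 h2).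
Qed.

Lemma pnormMn x n : nrm (x *+ n) = n%:R `^ p * nrm x.
Proof. by rewrite -scaler_nat pnormZ normc_nat. Qed.

Lemma pnorm_cvg_norm (u : nat -> B) l :
  (fun n => nrm (u n - l)) @ \oo --> (0 : R) -> nrm (u n) @[n --> \oo] --> nrm l.
Proof.
move=> /cvgrPdist_lt h; apply/cvgrPdist_lt => e e0; near=> n.
rewrite distrC; apply: (le_lt_trans (ler_pdist _ _)).
have : `|0 - nrm (u n - l)| < e by near: n; exact: h.
by rewrite sub0r normrN ger0_norm ?pnorm_ge0.
Unshelve. all: by end_near.
Qed.

Lemma pnorm_squeeze (u : nat -> B) l (f : nat -> R) :
  (forall n, nrm (u n - l) <= f n) -> f @ \oo --> (0 : R) ->
  (fun n => nrm (u n - l)) @ \oo --> (0 : R).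
Proof.
move=> h f0; apply: (@squeeze_cvgr _ _ _ _ (fun=> 0) f) f0; last exact: cvg_cst.
by near=> n; rewrite pnorm_ge0 h.
Unshelve. all: by end_near.
Qed.

Lemma pnorm_lim_unique (u : nat -> B) l l' :
  (fun n => nrm (u n - l)) @ \oo --> (0 : R) ->
  (fun n => nrm (u n - l')) @ \oo --> (0 : R) -> l = l'.
Proof.
move=> h h'; apply/eqP; rewrite -subr_eq0; apply/eqP/pnorm_eq0.
apply: (@cvg_unique _ (@Rhausdorff R) ((fun=> nrm (l - l')) @ \oo)).
  exact: cvg_cst.
apply: (@squeeze_cvgr _ _ _ _ (fun=> 0) (fun n => nrm (u n - l) + nrm (u n - l'))).
- near=> n; rewrite pnorm_ge0 /= (pdistC (u n) l).
  exact: pdist_triangle.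
- exact: cvg_cst.
- by rewrite -(addr0 (0 : R)); apply: cvgD.
Unshelve. all: by end_near.
Qed.

Lemma pnorm_limD (u v : nat -> B) l m :
  (fun n => nrm (u n - l)) @ \oo --> (0 : R) ->
  (fun n => nrm (v n - m)) @ \oo --> (0 : R) ->
  (fun n => nrm (u n + v n - (l + m))) @ \oo --> (0 : R).
Proof.
move=> h h'; apply: (@pnorm_squeeze _ _ (fun n => nrm (u n - l) + nrm (v n - m))).
  by move=> n; rewrite opprD addrACA pnormD.
by rewrite -(addr0 (0 : R)); apply: cvgD.
Qed.

Lemma pnorm_limZ (a : R[i]) (u : nat -> B) l :
  (fun n => nrm (u n - l)) @ \oo --> (0 : R) ->
  (fun n => nrm (a *: u n - a *: l)) @ \oo --> (0 : R).
Proof.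
move=> h; apply: (@pnorm_squeeze _ _ (fun n => normc a `^ p * nrm (u n - l))).
  by move=> n; rewrite -scalerBr pnormZ.
by rewrite -(mulr0 (normc a `^ p)); apply: cvgMl_tmp.
Qed.

Lemma pnorm_limM (u v : nat -> B) l m :
  (fun n => nrm (u n - l)) @ \oo --> (0 : R) ->
  (fun n => nrm (v n - m)) @ \oo --> (0 : R) ->
  (fun n => nrm (u n * v n - l * m)) @ \oo --> (0 : R).
Proof.
move=> h h'.
apply: (@pnorm_squeeze _ _
  (fun n => nrm (u n - l) * nrm (v n) + nrm l * nrm (v n - m))).
  move=> n; rewrite (_ : u n * v n - l * m = (u n - l) * v n + l * (v n - m)).
    by apply: (le_trans (pnormD _ _)); apply: lerD; apply: pnormM.
  by rewrite mulrBl mulrBr addrA subrK.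
rewrite (_ : 0 = 0 * nrm m + nrm l * 0 :> R); last by rewrite mul0r mulr0 addr0.
apply: cvgD; apply: cvgM => //; last exact: cvg_cst.
exact: pnorm_cvg_norm.
Qed.

Section Uniform.
Hypothesis uni : uniform_norm nrm.

Lemma unorm_pow2 x k : nrm (x ^+ (2 ^ k)) = nrm x ^+ (2 ^ k).
Proof.
elim: k => [|k IH]; first by rewrite expn0 !expr1.
by rewrite expnS mulnC exprM uni IH -exprM.
Qed.

Lemma unorm1 : nrm 1 = 1.
Proof.
have h := uni 1; rewrite expr1n in h.
have h0 : nrm 1 != 0 by apply/eqP => /pnorm_eq0/eqP; rewrite oner_eq0.
by apply: (mulfI h0); rewrite mulr1 -expr2 -h.
Qed.

Lemma unormX x n : nrm (x ^+ n) <= nrm x ^+ n.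
Proof.
elim: n => [|n IH]; first by rewrite !expr0 unorm1.
rewrite !exprS; apply: (le_trans (pnormM _ _)).
by apply: ler_wpM2l => //; exact: pnorm_ge0.
Qed.

(** Compare (x y)^(n+1) = x (y x)^n y for n + 1 = 2^k: the outer factors x and y
    disappear in the limit of the roots. *)
Lemma unorm_mulC_le x y : nrm (x * y) <= nrm (y * x).
Proof.
have [t0|tn0] := eqVneq (nrm (y * x)) 0.
  have h : nrm (x * y) ^+ 2 <= 0.
    rewrite -uni expr2 mulrA -(mulrA x y x).
    apply: (le_trans (pnormM _ _)); apply: (le_trans (ler_wpM2r (pnorm_ge0 _) (pnormM _ _))).
    by rewrite t0 mulr0 mul0r.
  rewrite t0; have := sqr_ge0 (nrm (x * y)).
  by rewrite le_eqVlt ltNge h orbF eq_sym sqrf_eq0 => /eqP ->.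
have tpos : 0 < nrm (y * x) by rewrite lt_neqAle eq_sym tn0 pnorm_ge0.
apply: (@le_of_pow2_growth _ _ _ (nrm x * nrm y / nrm (y * x))) => [|k].
  exact: pnorm_ge0.
rewrite -unorm_pow2; set n := (2 ^ k)%N.
have n0 : (0 < n)%N by rewrite expn_gt0.
have E m : (x * y) ^+ m.+1 = x * (y * x) ^+ m * y.
  elim: m => [|m IH]; first by rewrite expr0 expr1 mulr1.
  by rewrite exprS IH exprS !mulrA.
rewrite -(prednK n0) E.
apply: (@le_trans _ _ (nrm x * nrm (y * x) ^+ n.-1 * nrm y)).
  apply: (le_trans (pnormM _ _)); apply: (ler_wpM2r (pnorm_ge0 _)).
  apply: (le_trans (pnormM _ _)); apply: (ler_wpM2l (pnorm_ge0 _)).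
  exact: unormX.
rewrite exprS; set c := nrm (y * x); set d := c ^+ n.-1.
have -> : nrm x * nrm y / c * n.-1.+2%:R * (c * d) = (nrm x * d * nrm y) * n.-1.+2%:R.
  by field; rewrite gt_eqF.
rewrite ler_peMr ?ler1n //.
by rewrite !mulr_ge0 ?pnorm_ge0 ?exprn_ge0 ?pnorm_ge0.
Qed.

(** Conjugation by an invertible element is thus isometric, which is what bounds
    the functions of a complex variable in the proof of commutativity. *)
Lemma unorm_mulC x y : nrm (x * y) = nrm (y * x).
Proof. by apply/le_anti; rewrite !unorm_mulC_le. Qed.

End Uniform.
End PNorm.

(** * Coefficients of polynomials bounded on a circle *)

Lemma big_ord_double (V : nmodType) (n : nat) (f : nat -> V) :
  \sum_(i < n.*2) f i = \sum_(i < n) (f i.*2 + f i.*2.+1).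
Proof.
elim: n => [|n IH]; first by rewrite !big_ord0.
by rewrite doubleS !big_ord_recr /= IH addrA.
Qed.

Section CircleBounds.
Variables (R : realType) (B : algType R[i]) (p : R) (nrm : B -> R).
Hypothesis p0 : 0 < p.
Hypothesis nrmP : p_normed_algebra p nrm.

Lemma pnormZ_le (l : R[i]) x : normc l <= 1 -> nrm (l *: x) <= nrm x.
Proof.
move=> l1; rewrite (pnormZ nrmP) ler_piMl ?(pnorm_ge0 nrmP) //.
have e : 1 `^ p = 1 :> R by rewrite powR1.
rewrite -[leRHS]e; apply: ge0_ler_powR; rewrite ?nnegrE ?normc_ge0 //.
exact: ltW.
Qed.

(** The even and the odd part of a polynomial in l are, up to a factor l,
    polynomials in l^2 of half the degree bounded by averages of values at l and
    - l.  Iterating isolates one coefficient.  The factor 2 at each step is a crude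
    bound for such an average, valid for every p: when p < 1 the mean of two
    elements can be larger than both. *)
Lemma cauchy_estimate (k : nat) (c : nat -> B) (M : R) :
  (forall l : R[i], normc l = 1 -> nrm (\sum_(i < 2 ^ k) l ^+ i *: c i) <= M) ->
  forall j, (j < 2 ^ k)%N -> nrm (c j) <= (2 ^ k)%:R * M.
Proof.
elim: k c M => [|k IH] c M H j jk.
  move: jk; rewrite expn0 ltnS leqn0 => /eqP ->.
  by have := H 1 (normc1 _); rewrite expn0 big_ord1 expr0 scale1r mul1r.
pose S (l : R[i]) := \sum_(i < 2 ^ k.+1) l ^+ i *: c i.
pose E (l : R[i]) := \sum_(i < 2 ^ k) l ^+ i *: c i.*2.
pose O (l : R[i]) := \sum_(i < 2 ^ k) l ^+ i *: c i.*2.+1.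
have SE l : S l = E (l ^+ 2) + l *: O (l ^+ 2).
  rewrite /S expnS mul2n (big_ord_double _ (fun i => l ^+ i *: c i)) big_split /=.
  rewrite scaler_sumr; congr (_ + _); apply: eq_bigr => i _.
    by rewrite -exprM mul2n.
  by rewrite scalerA -exprM mul2n -exprS.
have S2 l x (m : R[i]) : normc l = 1 -> normc m = 1 ->
    x = (2^-1 * m) *: (S l + S (- l)) \/
    x = (2^-1 * m) *: (S l - S (- l)) -> nrm x <= 2 * M.
  move=> l1 m1 h; have {h} : nrm x <= nrm (S l) + nrm (S (- l)).
    have c2 : normc (2^-1 * m) <= 1.
      by rewrite normcM m1 mulr1 normcV normc_nat invf_le1 ?ler1n.
    case: h => ->; apply: (le_trans (pnormZ_le _ c2)).
      exact: pnormD nrmP _ _.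
    exact: pnormB nrmP _ _.
  have h1 := H l l1; have h2 := H (- l); rewrite normc_opp in h2.
  have {}h2 := h2 l1; rewrite -/(S l) in h1; rewrite -/(S (- l)) in h2; lra.
have half (x : B) : (2^-1 : R[i]) *: (x + x) = x.
  by rewrite -mulr2n -(scaler_nat 2 x) scalerA mulVf ?scale1r // pnatr_eq0.
have HE m : normc m = 1 -> nrm (E m) <= 2 * M.
  move=> m1; apply: (S2 (sqrtc m) _ 1); rewrite ?normc1 ?normc_sqrtc //; left.
  by rewrite !SE sqrrN !sqr_sqrtc scaleNr addrACA subrr addr0 mulr1 half.
have HO m : normc m = 1 -> nrm (O m) <= 2 * M.
  move=> m1; have l1 := normc_sqrtc m1; set l := sqrtc m in l1.
  have ln0 : l != 0 by apply/eqP => l0;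
    move: l1; rewrite l0 normc0 => /eqP; rewrite eq_sym oner_eq0.
  apply: (S2 l _ l^-1); rewrite ?normcV ?l1 ?invr1 //; right.
  rewrite !SE sqrrN !sqr_sqrtc scaleNr opprD opprK addrACA subrr add0r.
  by rewrite -scalerDr scalerA -mulrA mulVf // mulr1 half.
have [oj|ej] := boolP (odd j); rewrite expnS natrM -mulrA mulrCA.
  have -> : j = (j./2).*2.+1 by rewrite -[LHS]odd_double_half oj.
  apply: (IH (fun i => c i.*2.+1)); first exact: HO.
  by rewrite ltn_half_double -mul2n -expnS.
have -> : j = (j./2).*2 by rewrite -[LHS]odd_double_half (negbTE ej).
apply: (IH (fun i => c i.*2)); first exact: HE.
by rewrite ltn_half_double -mul2n -expnS.
Qed.

Hypothesis uni : uniform_norm nrm.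

(** The radius 2^-k is the square root of 1/n: by cyclicity the two outer factors
    combine to (1 - l^2 a^2)^n, whose binomial terms are then dominated by a
    geometric series. *)
Lemma conj_bound (k : nat) (a b : B) (m : R[i]) (n := (4 ^ k)%N)
    (l := m * ((2 ^ k)%:R)^-1) :
  nrm a <= 2^-1 -> normc m = 1 ->
  nrm ((1 + l *: a) ^+ n * b * (1 - l *: a) ^+ n) <= 2 * nrm b.
Proof.
move=> a12 m1.
rewrite (unorm_mulC nrmP uni) mulrA; apply: (le_trans (pnormM nrmP _ _)).
apply: (ler_wpM2r (pnorm_ge0 nrmP _)).
pose z := - l ^+ 2.
have l2 : normc z = (n%:R)^-1.
  rewrite normc_opp exprMn normcM !normcX m1 expr1n mul1r.
  by rewrite normcV normc_nat /n exprVn -natrX -expnM mulnC expnM.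
have cxy : GRing.comm (1 - l *: a) (1 + l *: a).
  by apply/commr_sym; apply: commrB; [exact: commr1 | apply: commr_sym; apply: commrD;
    [exact: commr1|]].
rewrite -exprMn_comm //.
have -> : (1 - l *: a) * (1 + l *: a) = 1 + z *: a ^+ 2.
  rewrite mulrBl mul1r mulrDr mulr1 opprD addrA addrK /z scaleNr.
  by rewrite -scalerAl -scalerAr scalerA -expr2 -expr2.
rewrite exprDn_comm; last exact/commr_sym/commr1.
apply: (le_trans (pnorm_sum p0 nrmP _ _ _)).
apply: (@le_trans _ _ (\sum_(i < n.+1) (2^-1 : R) ^+ i)).
  apply: ler_sum => i _; rewrite expr1n mul1r exprZn -scaler_nat scalerA.
  apply: (le_trans (pnormZ_le _ _)).
    rewrite normcM normc_nat normcX l2 exprVn -natrX ler_pdivrMr ?mul1r ?ler_nat.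
      exact: bin_le_expn.
    by rewrite ltr0n !expn_gt0.
  apply: (le_trans (unormX nrmP uni _ _)); rewrite uni.
  rewrite lerXn2r ?nnegrE ?sqr_ge0 ?invr_ge0 //.
  apply: (@le_trans _ _ (2^-1 ^+ 2)); first by rewrite lerXn2r ?nnegrE ?(pnorm_ge0 nrmP).
  lra.
suff -> : forall j, \sum_(i < j) (2^-1 : R) ^+ i = 2 - 2 * 2^-1 ^+ j.
  have : 0 <= (2^-1 : R) ^+ n.+1 by rewrite exprn_ge0.
  lra.
elim=> [|j IH]; first by rewrite big_ord0 expr0 mulr1 subrr.
by rewrite big_ord_recr /= IH exprS; field.
Qed.
End CircleBounds.

(** * Commutativity of uniform p-normed algebras *)

Definition ad (B : nzRingType) (a x : B) : B := a * x - x * a.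

Lemma adM (B : nzRingType) (a x y : B) : ad a (x * y) = ad a x * y + x * ad a y.
Proof. by rewrite /ad mulrBl mulrBr !mulrA addrA subrK. Qed.

Lemma adD (B : nzRingType) (a x y : B) : ad a (x + y) = ad a x + ad a y.
Proof. by rewrite /ad mulrDl mulrDr opprD addrACA. Qed.

Lemma ad0 (B : nzRingType) (a : B) : ad a 0 = 0.
Proof. by rewrite /ad mulr0 mul0r subrr. Qed.

Lemma adMn (B : nzRingType) (a x : B) n : ad a (x *+ n) = ad a x *+ n.
Proof. by rewrite /ad mulrnAr mulrnAl mulrnBl. Qed.

(** Since ad_a(c) is killed by ad_a, applying ad_a repeatedly to c^n by the Leibniz
    rule lets each application differentiate a different factor. *)
Lemma ad_pow (B : nzRingType) (a c : B) n : ad a (ad a c) = 0 ->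
  iter n (ad a) (c ^+ n) = ad a c ^+ n *+ n`! /\ iter n.+1 (ad a) (c ^+ n) = 0.
Proof.
move=> dd; set d := ad a c.
have L y k : iter k.+1 (ad a) (c * y) =
    c * iter k.+1 (ad a) y + (d * iter k (ad a) y) *+ k.+1.
  elim: k => [|k IH]; first by rewrite /= adM -/d mulr1n addrC.
  rewrite iterS IH adD adM -/d adMn adM dd mul0r add0r.
  by rewrite -!iterS [X in X + _]addrC -addrA -mulrS.
elim: n => [|n [IH1 IH2]].
  by rewrite /= !expr0 fact0 mulr1n /ad mulr1 mul1r subrr.
split; rewrite exprS L.
  by rewrite IH1 IH2 mulr0 add0r mulrnAr -exprS -mulrnA factS mulnC.
by rewrite iterS IH2 ad0 mulr0 mulr0 mul0rn addr0.
Qed.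

Section Commutative.
Variables (R : realType) (B : algType R[i]) (p : R) (nrm : B -> R).
Hypothesis p0 : 0 < p.
Hypothesis nrmP : p_normed_algebra p nrm.
Hypothesis uni : uniform_norm nrm.

Lemma pnorm_iter_ad (a y : B) n :
  nrm (iter n (ad a) y) <= (2 * nrm a) ^+ n * nrm y.
Proof.
elim: n => [|n IH] /=; first by rewrite expr0 mul1r.
apply: (le_trans (pnormB nrmP _ _)).
have h1 := pnormM nrmP a (iter n (ad a) y).
have h2 := pnormM nrmP (iter n (ad a) y) a.
have h3 := ler_wpM2l (pnorm_ge0 nrmP a) IH.
rewrite exprS -mulrA; lra.
Qed.

(** With d = ad_a(c), the identity ad_a^n(c^n) = n! d^n bounds n!^p |d|^n by a
    geometric sequence, so d = 0 because |d^n| = |d|^n for n = 2^k. *)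
Lemma kleinecke_shirokov (a c : B) : ad a (ad a c) = 0 -> ad a c = 0.
Proof.
move=> dd; have [//|dn0] := eqVneq (ad a c) 0.
set d := ad a c; set s := nrm d.
have s0 : 0 < s.
  rewrite lt_neqAle (pnorm_ge0 nrmP) andbT eq_sym; apply: contra dn0.
  move=> /eqP/(pnorm_eq0 nrmP) h.
  exact/eqP.
pose T := (2 * nrm a * nrm c / s) `^ p^-1.
have hT k : (2 ^ k)`!%:R <= T ^+ (2 ^ k).
  have [h _] := ad_pow (2 ^ k) dd.
  have := pnorm_iter_ad a (c ^+ (2 ^ k)) (2 ^ k).
  rewrite h (pnormMn nrmP) !(unorm_pow2 uni) -exprMn -/d -/s.
  rewrite -ler_pdivlMr ?exprn_gt0 // -expr_div_n => {}h.
  have Q0 : 0 <= 2 * nrm a * nrm c / s.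
    by rewrite !mulr_ge0 ?(pnorm_ge0 nrmP) // invr_ge0 ltW.
  have := @ge0_ler_powR R p^-1 _ _ _ _ _ h; rewrite !nnegrE powR_ge0
    exprn_ge0 // invr_ge0 (ltW p0).
  move=> /(_ isT isT isT); rewrite -powRrM mulfV ?gt_eqF // powRr1 ?ler0n // => {}h.
  apply: (le_trans h); rewrite /T.
  by rewrite powRXn.
have := @cvg_exp_coeff R T => /cvgrPdist_lt /(_ 1 ltr01) [N _ hN].
have [k0 hk] := natr_le_pow2 (N%:R : R).
have := hN (2 ^ k0)%N; rewrite /= -(ler_nat R) (ltW (hk _ (leqnn _))) => /(_ isT).
rewrite sub0r normrN ger0_norm; last first.
  by rewrite exp_coeff_ge0 // powR_ge0.
by rewrite /exp_coeff ltr_pdivrMr ?ltr0n ?fact_gt0 // mul1r ltNge hT.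
Qed.

(** The z^j coefficient of f(za) b f(-za) for the power series f with coefficients
    q: those of exp for q i = 1/i!, and of (1 + z/n)^n for q i = 'C(n, i) / n^i. *)
Definition conj_coef (q : nat -> R) (a b : B) (j : nat) :=
  \sum_(i < j.+1) (q i * q (j - i)%N)%:C%C *: (a ^+ i * b * (- a) ^+ (j - i)).

(** This is d/dz (exp(za) b exp(-za)) = ad_a(exp(za) b exp(-za)) read on
    coefficients; as a and b do not commute, the two sides of the derivative
    come from the two exponentials. *)
Lemma conj_coef_rec (a b : B) j :
  j.+1%:R *: conj_coef (fun i => i`!%:R^-1) a b j.+1 =
  ad a (conj_coef (fun i => i`!%:R^-1) a b j).
Proof.
set q : nat -> R := fun i => _.
have qS i : i.+1%:R * q i.+1 = q i.
  by rewrite /q factS natrM invfM mulrA mulfV ?mul1r // pnatr_eq0.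
pose t i l := a ^+ i * b * (- a) ^+ l.
rewrite /conj_coef scaler_sumr.
transitivity (\sum_(i < j.+2) (i%:R * q i * q (j.+1 - i)%N)%:C%C *: t i (j.+1 - i)%N +
   \sum_(i < j.+2) (q i * ((j.+1 - i)%N%:R * q (j.+1 - i)%N))%:C%C *: t i (j.+1 - i)%N).
  rewrite -big_split; apply: eq_bigr => -[i hi] _ /=.
  rewrite scalerA -scalerDl; congr (_ *: _).
  rewrite -(rmorph_nat (real_complex R)) -rmorphM -rmorphD /=; congr (_%:C%C).
  have -> : j.+1%:R = i%:R + (j.+1 - i)%:R :> R by rewrite -natrD subnKC.
  by ring.
rewrite /ad; congr (_ + _).
  rewrite big_ord_recl /= mul0r mul0r scale0r add0r mulr_sumr.
  apply: eq_bigr => i _; rewrite /bump /= add1n subSS qS -scalerAr; congr (_ *: _).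
  by rewrite /t exprS !mulrA.
rewrite big_ord_recr /= subnn mul0r mulr0 scale0r addr0 mulr_suml -sumrN.
apply: eq_bigr => -[i hi] _ /=; rewrite subSn // qS -scalerAl -scalerN; congr (_ *: _).
by rewrite /t exprSr !mulrN !mulrA.
Qed.

Lemma conj_coef_ad (a b : B) j :
  j`!%:R *: conj_coef (fun i => i`!%:R^-1) a b j = iter j (ad a) b.
Proof.
have adZ (l : R[i]) x : ad a (l *: x) = l *: ad a x.
  by rewrite /ad -scalerAr -scalerAl scalerBr.
elim: j => [|j IH].
  by rewrite /conj_coef big_ord1 fact0 invr1 mulr1 !expr0 mul1r mulr1 !scale1r.
by rewrite factS mulnC natrM -scalerA conj_coef_rec -adZ IH.
Qed.

Lemma conj_coef_cvg (q : nat -> nat -> R) (q' : nat -> R) a b j :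
  (forall i, q^~ i @ \oo --> q' i) ->
  (fun n => nrm (conj_coef (q n) a b j - conj_coef q' a b j)) @ \oo --> (0 : R).
Proof.
move=> hq.
apply: (@pnorm_squeeze _ _ _ _ nrmP _ _ (fun n => \sum_(i < j.+1)
  `|q n i * q n (j - i)%N - q' i * q' (j - i)%N| `^ p
    * nrm (a ^+ i * b * (- a) ^+ (j - i)))) => [n|].
  rewrite /conj_coef -sumrB; apply: (le_trans (pnorm_sum p0 nrmP _ _ _)).
  apply: ler_sum => i _.
  by rewrite -scalerBl (pnormZ nrmP) -rmorphB normc_real.
rewrite [X in _ --> X](_ : 0 = \sum_(i < j.+1) 0 * nrm (a ^+ i * b * (- a) ^+ (j - i))).
  apply: cvg_big => [|i _]; first exact: add_continuous.
  apply: cvgMr_tmp; apply: cvg_powR0 => //.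
  rewrite -[X in _ --> X](subrr (q' i * q' (j - i)%N)).
  by apply: cvgB; [apply: cvgM; exact: hq | exact: cvg_cst].
by rewrite big1 // => i _; rewrite mul0r.
Qed.

(** Cauchy's estimate on the circle |z| = 2^k for n = 4^k: the variable of
    conj_bound is l = z / n, of modulus 2^-k.  The right-hand side grows like 4^k
    whatever j is. *)
Lemma conj_coef_bound (k : nat) (a b : B) j : nrm a <= 2^-1 -> (j < 2 ^ k.*2.+2)%N ->
  ((2 ^ k)%:R ^+ j) `^ p *
     nrm (conj_coef (fun i => 'C(4 ^ k, i)%:R / (4 ^ k)%:R ^+ i) a b j) <=
  (2 ^ k.*2.+2)%:R * (2 * nrm b).
Proof.
move=> a12 jk; set n := (4 ^ k)%N; set q : nat -> R := fun i => _.
have sz : (n.*2.+1 <= 2 ^ k.*2.+2)%N.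
  have : (0 < n)%N by rewrite expn_gt0.
  have E : (2 ^ k.*2 = n)%N by rewrite -mul2n expnM.
  by rewrite !expnS E; lia.
pose c i : R := 'C(n, i)%:R / (2 ^ k)%:R ^+ i.
(* The a^i b and (- a)^i factors stay on their sides of b in the product P Q. *)
pose P := \poly_(i < n.+1) ((c i)%:C%C *: (a ^+ i * b)).
pose Q := \poly_(i < n.+1) ((c i)%:C%C *: (- a) ^+ i).
have cn i : (n < i)%N -> c i = 0 by move=> h; rewrite /c bin_small // mul0r.
have PE i : P`_i = (c i)%:C%C *: (a ^+ i * b).
  by rewrite coef_poly ltnS; case: leqP => // /cn ->; rewrite scale0r.
have QE i : Q`_i = (c i)%:C%C *: (- a) ^+ i.
  by rewrite coef_poly ltnS; case: leqP => // /cn ->; rewrite scale0r.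
have PQE : (P * Q)`_j = ((2 ^ k)%:R ^+ j)%:C%C *: conj_coef q a b j.
  rewrite coefM /conj_coef scaler_sumr; apply: eq_bigr => -[i hi] _ /=.
  rewrite PE QE -scalerAl -scalerAr !scalerA; congr (_ *: _).
  rewrite -!rmorphM; congr (_%:C%C).
  rewrite /c /q (_ : (n%:R : R) = (2 ^ k)%:R * (2 ^ k)%:R); last first.
    by rewrite -natrM -expnMn.
  have -> : ((2 ^ k)%:R ^+ j : R) = (2 ^ k)%:R ^+ i * (2 ^ k)%:R ^+ (j - i).
    by rewrite -exprD subnKC.
  by rewrite !exprMn; field; rewrite !expf_eq0 pnatr_eq0 expn_eq0 /= !andbF.
rewrite -[X in X `^ p]ger0_norm ?exprn_ge0 // -normc_real -(pnormZ nrmP) -PQE.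
apply: (cauchy_estimate p0 nrmP) jk => l l1.
pose L : R[i] := l / (2 ^ k)%:R.
suff -> : \sum_(i < 2 ^ k.*2.+2) l ^+ i *: (P * Q)`_i =
    (1 + L *: a) ^+ n * b * (1 - L *: a) ^+ n.
  exact: (conj_bound p0 nrmP uni).
have ll (x : B) : GRing.comm x l%:A by rewrite /GRing.comm -scalerAr -scalerAl mul1r mulr1.
have H m (x : nat -> B) : \sum_(i < m) l ^+ i *: x i = \sum_(i < m) x i * l%:A ^+ i.
  by apply: eq_bigr => i _; rewrite exprZn expr1n -scalerAr mulr1.
rewrite H -horner_coef_wide; last first.
  apply: (leq_trans (size_polyMleq _ _)); apply: leq_trans sz.
  have sP : (size P <= n.+1)%N by exact: size_poly.
  have sQ : (size Q <= n.+1)%N by exact: size_poly.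
  by apply: leq_trans (_ : (n.+1 + n.+1).-1 <= _)%N;
    [rewrite -!subn1 leq_sub2r // leq_add|lia].
rewrite hornerM_comm; last by rewrite /comm_poly ll.
rewrite !horner_poly -(H _ (fun i => (c i)%:C%C *: (a ^+ i * b))).
rewrite -(H _ (fun i => (c i)%:C%C *: (- a) ^+ i)).
have hcL i : l ^+ i * (c i)%:C%C = 'C(n, i)%:R * L ^+ i.
  rewrite /L /c exprMn exprVn rmorphM /= fmorphV rmorphXn /=.
  by rewrite -[(_%:R)%:C%C]/(real_complex R _) !rmorph_nat mulrCA.
congr (_ * _).
  rewrite exprDn_comm; last exact/commr_sym/commr1.
  rewrite mulr_suml; apply: eq_bigr => -[i hi] _ /=.
  rewrite expr1n mul1r exprZn -scaler_nat -!scalerAl !scalerA; congr (_ *: _).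
  exact: hcL.
rewrite -scalerN exprDn_comm; last exact/commr_sym/commr1.
apply: eq_bigr => -[i hi] _ /=.
by rewrite expr1n mul1r exprZn -scaler_nat !scalerA hcL.
Qed.

(** A Liouville argument.  The loss in Cauchy's estimate is 4^k for every j, while
    the gain (2^k)^(pj) is at least 8^k once j is large. *)
Lemma iter_ad_eq0 (a b : B) : nrm a <= 2^-1 -> exists j, iter j (ad a) b = 0.
Proof.
move=> a12; set w : R := 2 `^ p.
have w1 : 1 < w.
  have e : 1 `^ p = 1 :> R by rewrite powR1.
  by rewrite -[ltLHS]e gt0_ltr_powR // ?nnegrE // ltr1n.
(* Any base above 4 would do: 8 leaves a factor 2^k. *)
have [j hj] : exists j, 8 <= w ^+ j.
  have [j hj] : exists j, 7 / (w - 1) < j%:R.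
    by exists (Num.Def.archi_bound (7 / (w - 1))); apply: archi_boundP;
      rewrite divr_ge0 // subr_ge0 ltW.
  exists j; move: hj; rewrite ltr_pdivrMr ?subr_gt0 // => hj.
  have := @bernoulli_ineq R (w - 1) j; rewrite subr_ge0 (ltW w1) => /(_ isT).
  rewrite (addrC 1 (w - 1)) subrK; lra.
exists j; rewrite -conj_coef_ad.
pose q k i : R := 'C(4 ^ k, i)%:R / (4 ^ k)%:R ^+ i.
suff -> : conj_coef (fun i => i`!%:R^-1) a b j = 0 by rewrite scaler0.
apply: (@pnorm_lim_unique _ _ _ _ nrmP (fun k => conj_coef (q k) a b j)).
  apply: conj_coef_cvg => i.
  have h4 : (fun k => 4 ^ k)%N @ \oo --> \oo.
    apply/cvgnyPge => A; near=> k.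
    have Ak : (A <= k)%N by near: k; exact: nbhs_infty_ge.
    by apply: (leq_trans Ak); apply: ltnW; exact: ltn_expl.
  exact: (cvg_comp _ _ h4 (@cvg_bin_ratio R i)).
have hl : (fun k => 8 * nrm b * 2^-1 ^+ k : R) @ \oo --> (0 : R).
  rewrite -(mulr0 (8 * nrm b)); apply: cvgMl_tmp; apply: cvg_expr.
  by rewrite ger0_norm; lra.
apply: (@squeeze_cvgr _ _ _ _ (fun=> 0) (fun k => 8 * nrm b * 2^-1 ^+ k)) hl;
  last exact: cvg_cst.
near=> k; rewrite (pnorm_ge0 nrmP) subr0 /=.
have jk : (j < 2 ^ k.*2.+2)%N.
  have kj : (j <= k)%N by near: k; exact: nbhs_infty_ge.
  by apply: (leq_ltn_trans _ (ltn_expl _ _)) => //; lia.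
have := conj_coef_bound b a12 jk; rewrite -/(q k).
set c := nrm (conj_coef _ _ _ _) => h.
have h8 : 8 ^+ k <= ((2 ^ k)%:R ^+ j) `^ p.
  by rewrite natrX -exprM mulnC exprM !powRXn ?exprn_ge0 //
    lerXn2r ?nnegrE ?exprn_ge0 ?powR_ge0.
have E4 : (2 ^ k.*2.+2)%:R = 4 * 4 ^+ k :> R.
  by rewrite -natrX -natrM !expnS -mul2n expnM mulnA.
have E8 : 8 ^+ k = 4 ^+ k * 2 ^+ k :> R by rewrite -exprMn; congr (_ ^+ _); lra.
rewrite exprVn ler_pdivlMr ?exprn_gt0 //.
have p4 : 0 < 4 ^+ k :> R by rewrite exprn_gt0.
have {}h := le_trans (ler_wpM2r (pnorm_ge0 nrmP _) h8) h.
rewrite -(ler_pM2l p4).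
rewrite -/c E8 E4 in h.
lra.
Unshelve. all: by end_near.
Qed.

(** Rescaling a brings its norm below 1/2, and ad_a is linear in a. *)
Theorem uniform_commutative : commutative (@GRing.mul B).
Proof.
have small a b : nrm a <= 2^-1 -> ad a b = 0.
  move=> a12; have [j hj] := iter_ad_eq0 b a12.
  elim: j hj => [/= ->|j IH]; first exact: ad0.
  case: j IH => // j IH hj; apply: IH => /=.
  exact: kleinecke_shirokov.
move=> a b.
have [n hn] : exists n : nat, nrm (((n.+1)%:R^-1 : R[i]) *: a) <= 2^-1.
  have h : (fun n => `|n.+1%:R^-1| `^ p * nrm a) @ \oo --> (0 : R).
    rewrite -(mul0r (nrm a)); apply: cvgMr_tmp; apply: cvg_powR0 => //.
    exact: (@cvg_harmonic R).
  have h2 : 0 < 2^-1 :> R by rewrite invr_gt0 ltr0n.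
  have [N _ hN] := cvgr0_norm_le _ h _ h2.
  exists N; have := hN N (leqnn _); rewrite (pnormZ nrmP) normcV normc_nat.
  by rewrite /= !ger0_norm ?mulr_ge0 ?powR_ge0 ?(pnorm_ge0 nrmP).
have := small _ b hn; rewrite /ad -scalerAl -scalerAr -scalerBr => /eqP.
by rewrite scaler_eq0 invr_eq0 pnatr_eq0 /= subr_eq0 => /eqP.
Qed.
End Commutative.

(** * The homogeneous norm *)

Section RootNorm.
Variables (R : realType) (B : algType R[i]) (p : R) (nrm : B -> R).
Hypothesis p0 : 0 < p.
Hypothesis nrmP : p_normed_algebra p nrm.
Hypothesis uni : uniform_norm nrm.
Local Notation N b := (nrm b `^ p^-1).

Lemma root_normK b : N b `^ p = nrm b.
Proof. by rewrite -powRrM mulVf ?gt_eqF // powRr1 // (pnorm_ge0 nrmP). Qed.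

Lemma root_normZ (l : R[i]) b : N (l *: b) = normc l * N b.
Proof.
rewrite (pnormZ nrmP) powRM ?powR_ge0 ?(pnorm_ge0 nrmP) // -powRrM mulfV ?gt_eqF //.
by rewrite powRr1 // normc_ge0.
Qed.

Lemma root_norm_le s b : 0 <= s -> nrm b <= s `^ p -> N b <= s.
Proof.
move=> s0 h; have <- : (s `^ p) `^ p^-1 = s by rewrite -powRrM mulfV ?gt_eqF // powRr1.
by apply: ge0_ler_powR; rewrite ?nnegrE ?powR_ge0 ?(pnorm_ge0 nrmP) // invr_ge0 ltW.
Qed.

Lemma root_norm_lt s b : 0 <= s -> N b < s -> nrm b < s `^ p.
Proof.
by move=> s0 h; rewrite -root_normK gt0_ltr_powR // ?nnegrE ?powR_ge0.
Qed.

(** Each binomial term of (s + t)^n is at most the whole sum, so that the n + 1 terms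
    cost only the factor n + 1, invisible after taking roots. *)
Lemma root_normD : commutative (@GRing.mul B) ->
  forall a b, N (a + b) <= N a + N b.
Proof.
move=> mC a b; set s := N a; set t := N b.
have s0 : 0 <= s by exact: powR_ge0. 
have t0 : 0 <= t by exact: powR_ge0. 
have st0 : 0 <= s + t by rewrite addr_ge0.
apply: root_norm_le => //.
apply: (@le_of_pow2_growth _ _ _ 1) => [|k]; first exact: powR_ge0.
rewrite -(unorm_pow2 uni) mul1r exprDn_comm; last exact: mC.
set n := (2 ^ k)%N; apply: (le_trans (pnorm_sum p0 nrmP _ _ _)).
have -> : n.+1%:R * ((s + t) `^ p) ^+ n = \sum_(i < n.+1) ((s + t) `^ p) ^+ n.
  by rewrite sumr_const card_ord mulr_natl.
apply: ler_sum => -[i hi] _ /=; rewrite (pnormMn nrmP).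
have -> : ((s + t) `^ p) ^+ n = ((s + t) ^+ n) `^ p by rewrite powRXn.
apply: (@le_trans _ _ ((s ^+ (n - i) * t ^+ i *+ 'C(n, i)) `^ p)); last first.
  apply: ge0_ler_powR; rewrite ?nnegrE ?exprn_ge0 ?mulrn_wge0 ?mulr_ge0
    ?exprn_ge0 //; first exact: ltW.
  rewrite exprDn (bigD1 (Ordinal hi)) //= lerDl sumr_ge0 // => j _.
  by rewrite mulrn_wge0 // mulr_ge0 ?exprn_ge0.
rewrite -(mulr_natl (s ^+ _ * _)) powRM ?mulr_ge0 ?exprn_ge0 //.
apply: ler_wpM2l; first exact: powR_ge0.
rewrite powRM ?exprn_ge0 // !powRXn // !root_normK.
apply: (le_trans (pnormM nrmP _ _)).
by apply: ler_pM; rewrite ?(pnorm_ge0 nrmP) ?(unormX nrmP uni).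
Qed.

Lemma root_norm_algebra : commutative (@GRing.mul B) -> p_normed_algebra 1 (fun b => N b).
Proof.
move=> mC; split=> [|a b]; first split.
- by move=> a; exact: powR_ge0.
- exact: root_normD.
- by move=> l a; rewrite root_normZ powRr1 ?normc_ge0.
- by move=> a h; apply: (pnorm_eq0 nrmP); rewrite -root_normK h powR0 // gt_eqF.
rewrite -powRM ?(pnorm_ge0 nrmP) //; apply: ge0_ler_powR.
- by rewrite invr_ge0 ltW.
- by rewrite nnegrE (pnorm_ge0 nrmP).
- by rewrite nnegrE mulr_ge0 ?(pnorm_ge0 nrmP).
- exact: pnormM nrmP a b.
Qed.

Lemma root_norm_uniform : uniform_norm (fun b => N b).
Proof. by move=> a; rewrite uni powRXn // (pnorm_ge0 nrmP). Qed.

Lemma root_norm_complete : complete_norm nrm -> complete_norm (fun b => N b).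
Proof.
move=> cpl u hu; have [|l hl] := cpl u.
  move=> e e0; have d0 : 0 < e `^ p^-1 by rewrite powR_gt0.
  have := hu _ d0; apply: filterS => -[m n] /= /(root_norm_lt (powR_ge0 _ _)).
  by rewrite -powRrM mulVf ?gt_eqF // powRr1 // ltW.
exists l; have p1 : 0 < p^-1 by rewrite invr_gt0.
have := cvg_powR0 p1 hl; apply: cvg_trans; apply: near_eq_cvg.
by near=> n; rewrite ger0_norm ?(pnorm_ge0 nrmP).
Unshelve. all: by end_near.
Qed.
End RootNorm.

(** * Approximation in the completion *)

Section Completion.
Variables (R : realType) (p : R) (A B : algType R[i]) (nrmA : A -> R) (nrmB : B -> R).
Variable iota : {lrmorphism A -> B}.
Hypothesis hB : completion p nrmA nrmB iota.

Lemma dense_seq (b : B) :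
  exists u : nat -> A, (fun n => nrmB (iota (u n) - b)) @ \oo --> (0 : R).
Proof.
have [nB _ _ den] := hB.
have /choice [u hu] : forall n : nat, exists a : A, nrmB (b - iota a) < n.+1%:R^-1.
  by move=> n; apply: den; rewrite invr_gt0.
exists u; apply: (pnorm_squeeze nB _ (@cvg_harmonic R)) => n.
by rewrite (pdistC nB) ltW // hu.
Qed.

Lemma completion_uniform : uniform_norm nrmA -> uniform_norm nrmB.
Proof.
have [nB _ iso _] := hB; move=> uni b.
have [u hu] := dense_seq b.
have h1 := pnorm_cvg_norm nB (pnorm_limM nB hu hu).
have h2 : (fun n => nrmB (iota (u n)) ^+ 2) @ \oo --> nrmB b ^+ 2.
  rewrite [X in _ --> X]expr2; under eq_fun do rewrite expr2.
  by apply: cvgM; exact: (pnorm_cvg_norm nB (u := fun n => iota (u n)) hu).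
have h3 : (fun n => nrmB (iota (u n) * iota (u n))) @ \oo --> nrmB b ^+ 2.
  move: h2; apply: cvg_trans; apply: near_eq_cvg.
  by near=> n; rewrite -rmorphM !iso -expr2 uni.
by rewrite expr2; exact: (cvg_unique (@Rhausdorff R) h1 h3).
Unshelve. all: by end_near.
Qed.
End Completion.

(** * Norm and spectrum in a commutative uniform Banach algebra *)

Section UniformBanach.
Variables (R : realType) (B : comAlgType R[i]) (N : B -> R).
Hypothesis NP : p_normed_algebra 1 N.
Hypothesis cpl : complete_norm N.
Hypothesis uni : uniform_norm N.

Let N0 := pnorm_ge0 NP.
Let ND := pnormD NP.
Let NB := pnormB NP.
Let NM := pnormM NP.
Let N1 : N 1 = 1 := unorm1 NP uni.

Lemma bnormZ (l : R[i]) x : N (l *: x) = normc l * N x.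
Proof. by rewrite (pnormZ NP) powRr1 ?normc_ge0. Qed.

Lemma neumann (x : B) : N x < 1 -> exists y, (1 - x) * y = 1.
Proof.
move=> x1; pose q := N x; have q0 : 0 <= q by exact: N0.
pose S n := \sum_(i < n) x ^+ i.
have tel n : (1 - x) * S n = 1 - x ^+ n.
  by rewrite /S -(opprB x 1) mulNr -subrX1 opprB.
have q1 : 0 < 1 - q by rewrite subr_gt0.
have dS m d : N (S (m + d)%N - S m) <= (q ^+ m - q ^+ (m + d)) / (1 - q).
  elim: d => [|d IH]; first by rewrite addn0 !subrr (pnorm0 ltr01 NP) mul0r.
  rewrite addnS /S big_ord_recr /= -/(S (m + d)%N) addrAC; apply: (le_trans (ND _ _)).
  apply: (le_trans (lerD IH (unormX NP uni _ _))); rewrite exprS -/q.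
  by rewrite ler_pdivlMr // mulrDl divfK ?gt_eqF //; lra.
have cS m n : N (S m - S n) <= (q ^+ m + q ^+ n) / (1 - q).
  wlog mn : m n / (n <= m)%N.
    move=> h; case: (leqP n m) => [|/ltnW] le; first exact: h.
    by rewrite (pdistC NP) (addrC (q ^+ m)) h.
  rewrite -(subnKC mn); apply: (le_trans (dS _ _)).
  rewrite ler_pM2r ?invr_gt0 //.
  have := exprn_ge0 (n + (m - n)) q0; lra.
have hq : (fun n => q ^+ n) @ \oo --> (0 : R).
  by apply: cvg_expr; rewrite ger0_norm.
have [|y hy] := cpl (u := S).
  move=> e e0; have e1 : 0 < e * (1 - q) / 2 by rewrite divr_gt0 // mulr_gt0.
  have [M _ hM] := cvgr0_norm_lt _ hq _ e1.
  exists ([set n | (M <= n)%N], [set n | (M <= n)%N]); first by split; exists M.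
  move=> [m n] /= [/hM + /hM]; rewrite /= !ger0_norm ?exprn_ge0 // => h1 h2.
  by apply: (le_lt_trans (cS _ _)); rewrite ltr_pdivrMr //; lra.
exists y; have h1 : (fun n => N ((1 - x) * S n - (1 - x) * y)) @ \oo --> (0 : R).
  apply: (pnorm_limM NP) => //; rewrite subrr.
  by rewrite (pnorm0 ltr01 NP); exact: cvg_cst.
apply: (pnorm_lim_unique NP h1).
apply: (pnorm_squeeze NP _ hq) => n.
by rewrite tel addrAC subrr add0r (pnormN NP) (unormX NP uni).
Qed.

(** In a commutative algebra one-sided inverses suffice (invertibleE), and a product
    is invertible exactly when its factors are (has_inverseM). *)
Definition has_inverse (x : B) := exists y, x * y = 1.

Lemma invertibleE x : invertible x <-> has_inverse x.
Proof. by split=> -[y]; [case=> h _|move=> h]; exists y => //; split => //; rewrite mulrC. Qed.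

Lemma has_inverseM x y : has_inverse (x * y) <-> has_inverse x /\ has_inverse y.
Proof.
split=> [[z h]|[[u hu] [v hv]]].
  by split; [exists (y * z)|exists (x * z)]; rewrite -h; ring.
by exists (u * v); rewrite mulrACA hu hv mulr1.
Qed.

Lemma has_inverse_scalar (l : R[i]) : l != 0 -> has_inverse l%:A.
Proof. by move=> l0; exists (l^-1)%:A; rewrite -scalerAl mul1r scalerA mulfV // scale1r. Qed.

Lemma not_has_inverse0 : ~ has_inverse 0.
Proof. by case=> y /esym/eqP; rewrite mul0r oner_eq0. Qed.

Lemma spectrumE b l : spectrum b l <-> ~ has_inverse (l%:A - b).
Proof. by split => h /invertibleE. Qed.

Lemma spectrum_le b l : spectrum b l -> normc l <= N b.
Proof.
move=> /spectrumE h; rewrite leNgt; apply/negP => bl; apply: h.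
have l0 : l != 0 by apply/eqP => l0; move: bl; rewrite l0 normc0 ltNge N0.
have -> : l%:A - b = l%:A * (1 - l^-1 *: b).
  by rewrite -scalerAl mul1r scalerBr scalerA mulfV // scale1r.
apply/has_inverseM; split; first exact: has_inverse_scalar.
apply: neumann; rewrite bnormZ normcV mulrC ltr_pdivrMr ?mul1r //.
exact: le_lt_trans (N0 b) bl.
Qed.

Definition circle (t : R) : R[i] := (cos t +i* sin t)%C.

Lemma normc_circle t : normc (circle t) = 1.
Proof. by rewrite /= cos2Dsin2 sqrtr1. Qed.

Lemma circle_surj (l : R[i]) : normc l = 1 -> exists2 t, t \in `[- pi, pi] & l = circle t.
Proof.
case: l => x y /= h.
have {}h : x ^+ 2 + y ^+ 2 = 1.
  by rewrite -[LHS]sqr_sqrtr ?addr_ge0 ?sqr_ge0 // h expr1n.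
have x1 : -1 <= x <= 1.
  rewrite -ler_norml -(expr_le1 (n := 2)) // real_normK ?num_real //.
  have := sqr_ge0 y; lra.
have a0 := acos_ge0 x1. have a1 := acos_lepi x1.
have yE : sin (acos x) = `|y| by rewrite sin_acos // -h addrAC subrr add0r sqrtr_sqr.
have [y0|y0] := leP 0 y.
  exists (acos x); first by rewrite in_itv /= a1 andbT; have := pi_ge0 R; lra.
  by rewrite /circle yE acosK // ger0_norm.
exists (- acos x); first by rewrite in_itv /=; have := pi_ge0 R; lra.
by rewrite /circle cosN sinN yE acosK // ltr0_norm // opprK.
Qed.

(** By the resolvent identity the reciprocal of the norm of the resolvent is a
    Lipschitz function of the parameter; it is positive on a compact circle, hence
    bounded below. *)
Lemma resolvent_bounded (c : B) : N c = 1 ->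
  (forall l, normc l = 1 -> has_inverse (1 - l *: c)) ->
  exists2 K, 0 < K & forall l, normc l = 1 -> exists2 y, (1 - l *: c) * y = 1 & N y <= K.
Proof.
move=> c1 H.
have /choice [r hr] : forall t, exists y, (1 - circle t *: c) * y = 1.
  by move=> t; apply: H; exact: normc_circle.
have rpos t : 0 < N (r t).
  rewrite lt_neqAle N0 andbT eq_sym; apply/eqP => /(pnorm_eq0 NP) h.
  by have := hr t; rewrite h mulr0 => /eqP; rewrite eq_sym oner_eq0.
have lip s t : N (r t) - N (r s) <= normc (circle t - circle s) * (N (r t) * N (r s)).
  have E : r t - r s = (circle t - circle s) *: (c * (r t * r s)).
    transitivity (((1 - circle s *: c) - (1 - circle t *: c)) * (r t * r s)).
      rewrite mulrBl mulrCA hr mulr1 mulrA hr mul1r //.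
    by rewrite opprB addrC addrA subrK -scalerBl -scalerAl.
  have h : N (r t) <= N (r t - r s) + N (r s) by have := ND (r t - r s) (r s); rewrite subrK.
  rewrite lerBlDr; apply: (le_trans h); rewrite lerD2r E bnormZ.
  apply: ler_wpM2l; first exact: normc_ge0.
  by apply: (le_trans (NM _ _)); rewrite c1 mul1r NM.
pose f t := (N (r t))^-1.
have flip s t : `|f s - f t| <= `|cos s - cos t| + `|sin s - sin t|.
  have E u v : f u - f v <= normc (circle u - circle v).
    have := lip u v; have -> : f u - f v = (N (r v) - N (r u)) / (N (r v) * N (r u)).
      by rewrite /f; field; rewrite !gt_eqF.
    by rewrite ler_pdivrMr ?mulr_gt0 // -normc_opp opprB.
  apply: (le_trans _ (normc_le_ReIm _ _)); rewrite -[(_ +i* _)%C]/(circle s - circle t).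
  rewrite ler_norml E andbT lerNl opprB -normc_opp opprB; exact: E.
have fcont : continuous f.
  move=> t; apply/cvgrPdist_lt => e e0.
  have e2 : 0 < e / 2 by rewrite divr_gt0.
  have /cvgrPdist_lt/(_ _ e2) hc := @continuous_cos R t.
  have /cvgrPdist_lt/(_ _ e2) hs := @continuous_sin R t.
  near=> s; apply: (le_lt_trans (flip _ _)).
  have h1 : `|cos t - cos s| < e / 2 by near: s.
  have h2 : `|sin t - sin s| < e / 2 by near: s.
  lra.
have [||t0 _ ht0] := @EVT_min R f (- pi) pi.
- by have := pi_ge0 R; lra.
- exact: continuous_subspaceT.
exists (N (r t0)) => // l /circle_surj [t ht ->]; exists (r t) => //.
by have := ht0 t ht; rewrite /f lef_pV2 ?posrE.
Unshelve. all: by end_near.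
Qed.

(** Rickart's averaging.  For k = 0, y and z are the resolvents at l and at the
    nearby point t l, and they are close by the resolvent identity.  The identity
    (1 - x^2)^-1 = ((1 - x)^-1 + (1 + x)^-1) / 2 then passes from c^(2^k) to its
    square without enlarging the distance. *)
Lemma resolvent_pow2 (c : B) (K e : R) : N c = 1 -> 0 < K -> 0 < e ->
  (forall l, normc l = 1 -> exists2 y, (1 - l *: c) * y = 1 & N y <= K) ->
  exists2 t : R, 0 < t < 1 & forall k (l : R[i]), normc l = 1 -> exists y z,
    [/\ (1 - l *: c ^+ (2 ^ k)) * y = 1,
        (1 - (t ^+ (2 ^ k))%:C%C *: (l *: c ^+ (2 ^ k))) * z = 1 &
        N (y - z) <= e].
Proof.
move=> c1 K0 e0 HK.
(* t = 1 - d, where d <= 1 / (2 K) keeps the norm of z below 2 K, and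
   d <= e / (2 K^2) makes the difference at most e. *)
pose d := (2 * K + 2 * K ^+ 2 / e + 2)^-1.
have D0 : 0 < 2 * K + 2 * K ^+ 2 / e + 2.
  have : 0 < 2 * K ^+ 2 / e by rewrite divr_gt0 // mulr_gt0 // exprn_gt0.
  lra.
have d0 : 0 < d by rewrite invr_gt0.
have dD : d * (2 * K) + d * (2 * K ^+ 2 / e) + d * 2 = 1.
  by rewrite -!mulrDr mulVf // gt_eqF.
have dK : 0 < d * (2 * K) by rewrite mulr_gt0 // mulr_gt0.
have dKe : 0 < d * (2 * K ^+ 2 / e).
  by rewrite mulr_gt0 // divr_gt0 // mulr_gt0 // exprn_gt0.
exists (1 - d); first by apply/andP; split; lra.
have tn : normc (1 - d)%:C%C = 1 - d by rewrite normc_real ger0_norm //; lra.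
elim=> [|k IH] l l1.
  have [y hy yK] := HK l l1.
  have [z hz] : exists z, (1 - (1 - d)%:C%C *: (l *: c)) * z = 1.
    by apply: neumann; rewrite !bnormZ tn l1 c1; lra.
  exists y, z; rewrite expn0 !expr1; split => //.
  have E : y - z = d%:C%C *: (l *: (c * (y * z))).
    transitivity (((1 - (1 - d)%:C%C *: (l *: c)) - (1 - l *: c)) * (y * z)).
      by rewrite mulrBl (mulrA (1 - l *: c) y z) hy mul1r mulrCA hz mulr1.
    rewrite rmorphB /= scalerBl scale1r !scalerAl; congr (_ * _); ring.
  have yz : N (y - z) <= d * (K * N z).
    rewrite E !bnormZ l1 mul1r normc_real ger0_norm ?(ltW d0) //.
    apply: ler_wpM2l; first exact: ltW.
    apply: (le_trans (NM _ _)); rewrite c1 mul1r; apply: (le_trans (NM _ _)).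
    exact: ler_wpM2r.
  have z2 : N z <= 2 * K.
    have h : N z <= N y + N (y - z) by have := NB y (y - z); rewrite opprB addrC subrK.
    have : d * K * N z <= 2^-1 * N z by apply: ler_wpM2r => //; lra.
    move: yz; rewrite mulrA; lra.
  apply: (le_trans yz).
  have : d * (K * N z) <= d * (K * (2 * K)) by rewrite ler_pM2l // ler_pM2l.
  move=> h; apply: (le_trans h).
  have : d * (2 * K ^+ 2 / e) <= 1 by lra.
  have -> : d * (2 * K ^+ 2 / e) = d * (K * (2 * K)) / e by field; rewrite gt_eqF.
  by rewrite ler_pdivrMr // mul1r.
have m1 := normc_sqrtc l1; set m := sqrtc l in m1.
have lE : l = m ^+ 2 by rewrite sqr_sqrtc.
have [y1 [z1 [hy1 hz1 h1]]] := IH m m1.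
have [|y2 [z2 [hy2 hz2 h2]]] := IH (- m); first by rewrite normc_opp.
have half (x : B) u v : (1 - x) * u = 1 -> (1 + x) * v = 1 ->
    (1 - x ^+ 2) * ((2^-1 : R[i]) *: (u + v)) = 1.
  move=> hu hv; rewrite -scalerAr.
  have -> : (1 - x ^+ 2) * (u + v) = (1 + x) * ((1 - x) * u) + (1 - x) * ((1 + x) * v) by ring.
  rewrite hu hv !mulr1 addrACA subrr addr0 -mulr2n -(scaler_nat 2 (1 : B)) scalerA mulVf ?scale1r //.
exists ((2^-1 : R[i]) *: (y1 + y2)), ((2^-1 : R[i]) *: (z1 + z2)); split.
- rewrite expnS mulnC exprM lE -exprZn; apply: half => //.
  by move: hy2; rewrite scaleNr opprK.
- rewrite expnS mulnC !exprM lE rmorphXn /= -!exprZn; apply: half => //.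
  by move: hz2; rewrite scaleNr scalerN opprK.
- rewrite -scalerBr opprD addrACA bnormZ normcV normc_nat.
  by rewrite ler_pdivrMl //; apply: (le_trans (ND _ _)); lra.
Qed.

(** If the resolvents existed on the whole circle, then, with t fixed and k large,
    z would be close to 1 since t^(2^k) is small; so would y be, whence c^(2^k)
    would have norm less than 1, although N c = 1 and N is uniform. *)
Lemma spectral_circle (c : B) : N c = 1 ->
  exists2 l, normc l = 1 & ~ has_inverse (1 - l *: c).
Proof.
move=> c1; apply: contrapT => H.
have {}H l : normc l = 1 -> has_inverse (1 - l *: c).
  by move=> l1; apply: contrapT => h; apply: H; exists l.
(* 1/8 and 1/16 give N (z - 1) <= 1/8 and N (y - 1) <= 1/4, so that d below,
   which equals (y - 1) (1 - d), has norm at most 1/2. *)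
have [K K0 HK] := resolvent_bounded c1 H.
have e0 : 0 < 8^-1 :> R by rewrite invr_gt0.
have [t /andP[t0 t1] Ht] := resolvent_pow2 c1 K0 e0 HK.
have [k hk] : exists k, t ^+ (2 ^ k) <= 16^-1.
  have ht : (fun n => t ^+ n) @ \oo --> (0 : R) by apply: cvg_expr; rewrite ger0_norm // ltW.
  have e1 : 0 < 16^-1 :> R by rewrite invr_gt0.
  have [k _ hk] := cvgr0_norm_le _ ht _ e1.
  have kk : (k <= 2 ^ k)%N by apply: ltnW; exact: ltn_expl.
  exists k; have := hk _ kk; rewrite ger0_norm //.
  by rewrite exprn_ge0 // ltW.
have [y [z [hy hz hyz]]] := Ht k 1 (normc1 _).
have d1 : N (c ^+ (2 ^ k)) = 1 by rewrite (unorm_pow2 uni) c1 expr1n.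
set d := c ^+ (2 ^ k) in hy hz d1; set s := t ^+ (2 ^ k) in hk hz.
have s0 : 0 <= s by rewrite exprn_ge0 // ltW.
rewrite !scale1r in hy hz.
have zE : z - 1 = s%:C%C *: (d * z).
  by rewrite -[X in _ - X]hz mulrBl mul1r opprB addrC subrK -scalerAl.
have hz1 : N (z - 1) <= s * N z.
  by rewrite zE bnormZ normc_real ger0_norm // ler_wpM2l // (le_trans (NM _ _)) // d1 mul1r.
have hz2 : N z <= N (z - 1) + 1 by have := ND (z - 1) 1; rewrite subrK N1.
have sz : s * N z <= 16^-1 * N z by apply: ler_wpM2r.
have hy1 : N (y - 1) <= 4^-1.
  have := ND (y - z) (z - 1); rewrite addrA subrK; lra.
have yE : y - 1 = d * y by rewrite -[X in _ - X]hy; ring.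
have : d = (y - 1) * (1 - d) by rewrite yE -mulrA (mulrC y) hy mulr1.
move=> /(congr1 N); rewrite d1 => h.
have := NM (y - 1) (1 - d); rewrite -h.
have := NB 1 d; rewrite N1 d1 => h2.
have : N (y - 1) * N (1 - d) <= 4^-1 * 2 by apply: ler_pM => //; lra.
lra.
Qed.

Lemma spectral_point (b : B) : exists2 l, spectrum b l & normc l = N b.
Proof.
have [b0|b0] := eqVneq (N b) 0.
  exists 0; last by rewrite b0 normc0.
  by apply/spectrumE; rewrite (pnorm_eq0 NP b0) scale0r subrr; exact: not_has_inverse0.
have bp : 0 < N b by rewrite lt_neqAle eq_sym b0 N0.
have nb : normc ((N b)%:C%C : R[i]) = N b by rewrite normc_real ger0_norm // ltW.
have [|l l1 hl] := @spectral_circle ((N b)%:C%C^-1 *: b).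
  by rewrite bnormZ normcV nb mulVf.
have l0 : l != 0 by apply/eqP => l0;
    move: l1; rewrite l0 normc0 => /eqP; rewrite eq_sym oner_eq0.
exists ((N b)%:C%C / l); last by rewrite normcM normcV l1 invr1 mulr1 nb.
apply/spectrumE => h; apply: hl.
have B0 : (N b)%:C%C != 0 :> R[i] by rewrite fmorph_eq0.
have -> : 1 - l *: ((N b)%:C%C^-1 *: b) = (l / (N b)%:C%C)%:A * (((N b)%:C%C / l)%:A - b).
  rewrite -scalerAl mul1r scalerBr !scalerA mulrA divfK // mulfV // scale1r.
  by [].
apply/has_inverseM; split => //; apply: has_inverse_scalar.
by rewrite mulf_neq0 // invr_neq0.
Qed.
End UniformBanach.

(** * Elements with real spectrum *)

Section Hermitian.
Variables (R : realType) (B : comAlgType R[i]) (N : B -> R).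
Hypothesis NP : p_normed_algebra 1 N.
Hypothesis cpl : complete_norm N.
Hypothesis uni : uniform_norm N.

Lemma has_inverseN (x : B) : has_inverse (- x) <-> has_inverse x.
Proof. by split=> -[y h]; exists (- y); rewrite -h ?mulrNN // mulrN mulNr. Qed.

Lemma spectrum_shift (b : B) c l : spectrum (c%:A - b) l <-> spectrum b (c - l).
Proof.
have E : (c - l)%:A - b = - (l%:A - (c%:A - b)).
  by rewrite scalerBl; set u := c%:A; set v := l%:A; ring.
split=> /spectrumE h; apply/spectrumE => h'; apply: h; first by apply/has_inverseN; rewrite -E.
by move: h'; rewrite E => /has_inverseN.
Qed.

Lemma spectrum_sqr (b : B) l :
  spectrum (b ^+ 2) l <-> exists2 m, spectrum b m & l = m ^+ 2.
Proof.
have E m : (m ^+ 2)%:A - b ^+ 2 = - ((m%:A - b) * ((- m)%:A - b)).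
  have -> : (m ^+ 2)%:A = m%:A ^+ 2 :> B by rewrite exprZn expr1n.
  by rewrite scaleNr; set u := m%:A; ring.
split=> [/spectrumE h|[m /spectrumE h ->]].
  have lE := sqr_sqrtc l; set m := sqrtc l in lE.
  apply: contrapT => h2; apply: h; rewrite -lE E; apply/has_inverseN/has_inverseM.
  split; apply: contrapT => h; apply: h2.
    by exists m => //; apply/spectrumE.
  by exists (- m); rewrite ?sqrrN //; apply/spectrumE.
by apply/spectrumE; rewrite E => /has_inverseN/has_inverseM [].
Qed.

Definition real_spectrum (b : B) := forall l, spectrum b l -> exists r : R, l = r%:C%C.
Definition nonneg_spectrum (b : B) :=
  forall l, spectrum b l -> exists2 r : R, 0 <= r & l = r%:C%C.

(** The spectrum of N x - x lies in [0, N x], and the norm is attained on the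
    spectrum.  This turns nonnegativity into a norm inequality, which adds up. *)
Lemma nonneg_norm (x : B) : nonneg_spectrum x -> N ((N x)%:C%C%:A - x) <= N x.
Proof.
move=> nx; have [l hl <-] := spectral_point NP cpl uni ((N x)%:C%C%:A - x).
have /spectrum_shift hs := hl; have [r r0 hr] := nx _ hs.
have := spectrum_le NP cpl uni hs; rewrite hr normc_real ger0_norm // => rN.
have -> : l = (N x - r)%:C%C by rewrite rmorphB /= -hr subKr.
rewrite normc_real ger0_norm; lra.
Qed.

Lemma nonnegD (x y : B) : nonneg_spectrum x -> nonneg_spectrum y ->
  real_spectrum (x + y) -> nonneg_spectrum (x + y).
Proof.
move=> hx hy hxy l hl; have [r lE] := hxy _ hl; exists r => //.
have h1 := nonneg_norm hx; have h2 := nonneg_norm hy.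
set s := N x in h1; set t := N y in h2.
have : spectrum ((s + t)%:C%C%:A - (x + y)) ((s + t)%:C%C - l).
  by apply/spectrum_shift; rewrite subKr.
move=> /(spectrum_le NP cpl uni); rewrite lE -rmorphB normc_real => h3.
have : N ((s + t)%:C%C%:A - (x + y)) <= s + t.
  rewrite rmorphD scalerDl opprD addrACA.
  by apply: (le_trans (pnormD NP _ _)); apply: lerD.
move=> h4; have := le_trans h3 h4; rewrite ler_norml => /andP[]; lra.
Qed.

Lemma nonneg_sqr (x : B) : real_spectrum x -> nonneg_spectrum (x ^+ 2).
Proof.
move=> hx l /spectrum_sqr [m /hx [r ->] ->]; exists (r ^+ 2); first exact: sqr_ge0.
by rewrite rmorphXn.
Qed.

Lemma nonneg_shift (x : B) (c d : R) :
  (forall r : R, spectrum x r%:C%C -> c <= r) -> real_spectrum x -> d <= c -> 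
  nonneg_spectrum (x - d%:C%C%:A).
Proof.
move=> hx rx dc l hl.
have : spectrum x (l + d%:C%C).
  move: hl => /spectrumE hl; apply/spectrumE => h; apply: hl; move: h.
  by rewrite scalerDl opprB addrA.
move=> hs; have [r hr] := rx _ hs; exists (r - d).
  by have := hx r; rewrite -hr => /(_ hs); lra.
by rewrite rmorphB /= -hr addrK.
Qed.

(** S stands for the image in B of the self-adjoint elements of A. *)
Variable S : set B.
Hypothesis S1 : S 1.
Hypothesis SD : forall x y, S x -> S y -> S (x + y).
Hypothesis SZ : forall (r : R) x, S x -> S (r%:C%C *: x).
Hypothesis Ssq : forall x, S x -> S (x ^+ 2).
Hypothesis Sreal : forall x, S x -> real_spectrum x.

Let SB x y : S x -> S y -> S (x - y).
Proof. by move=> hx hy; apply: SD => //; have := SZ (-1) hy; rewrite rmorphN1 scaleN1r. Qed.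

Let Sscal (r : R) : S (r%:C%C%:A). Proof. exact: SZ. Qed.

(** A joint spectral point (r, s) of h and k would satisfy x = r, y = s and
    r^2 + s^2 <= N (h^2 + k^2).  In place of joint spectra, the proof uses squares of
    the two combinations u and j of h and k, which at such a point take the values
    x^2 + y^2 and 0. *)
Lemma spectrum_hermitian_le (h k : B) (l : R[i]) : S h -> S k ->
  spectrum (h + 'i%C *: k) l -> normc l ^+ 2 <= N (h ^+ 2 + k ^+ 2).
Proof.
move=> Sh Sk; case: l => x y /spectrumE hl.
pose M := x ^+ 2 + y ^+ 2.
have M0 : 0 <= M by rewrite addr_ge0 ?sqr_ge0.
have -> : normc (x +i* y)%C ^+ 2 = M by rewrite /= sqr_sqrtr.
set G := h ^+ 2 + k ^+ 2; set g := N G; rewrite leNgt; apply/negP => gM.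
have g0 : 0 <= g by exact: (pnorm_ge0 NP).
pose u := x%:C%C *: h + y%:C%C *: k; pose j := x%:C%C *: k - y%:C%C *: h.
pose X : B := x%:C%C%:A; pose Y : B := y%:C%C%:A; pose I : B := 'i%C%:A.
have XE (b : B) : x%:C%C *: b = X * b by rewrite mulr_algl.
have YE (b : B) : y%:C%C *: b = Y * b by rewrite mulr_algl.
have IE (b : B) : 'i%C *: b = I * b by rewrite mulr_algl.
have ME : M%:C%C%:A = X ^+ 2 + Y ^+ 2 :> B.
  by rewrite !exprZn expr1n -scalerDl rmorphD /= !rmorphXn.
have MZ (b : B) : M%:C%C *: b = (X ^+ 2 + Y ^+ 2) * b by rewrite -ME mulr_algl.
have I2 : I ^+ 2 = -1 by rewrite exprZn expr1n sqr_i scaleN1r.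
have Su : S u by apply: SD; exact: SZ.
have Sj : S j by apply: SB; exact: SZ.
have SG : S G by apply: SD; exact: Ssq.
have nG : nonneg_spectrum G.
  apply: nonnegD; [exact/nonneg_sqr/Sreal|exact/nonneg_sqr/Sreal|exact: Sreal].
(* The spectral form of u^2 <= M g: the difference is M (g - G) + j^2. *)
have nMG : nonneg_spectrum ((M * g)%:C%C%:A - u ^+ 2).
  have -> : (M * g)%:C%C%:A - u ^+ 2 = (M%:C%C%:A * (g%:C%C%:A - G)) + j ^+ 2.
    rewrite rmorphM /= -scalerA !MZ /u /j /G !XE !YE; set g' := g%:C%C%:A; ring.
  have Sg : S (M%:C%C%:A * (g%:C%C%:A - G)).
    by rewrite mulr_algl; apply: SZ; apply: SB.
  apply: nonnegD; [|exact/nonneg_sqr/Sreal|apply: Sreal; apply: SD => //; exact: Ssq].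
  move=> l /spectrumE hl'; have Mn0 : M != 0 by rewrite gt_eqF // (le_lt_trans g0).
  have McN0 : M%:C%C != 0 :> R[i] by rewrite fmorph_eq0.
  have : spectrum (g%:C%C%:A - G) (l / M%:C%C).
    apply/spectrumE => h'; apply: hl'.
    have -> : l%:A = M%:C%C%:A * (l / M%:C%C)%:A :> B.
      by rewrite mulr_algl scalerA mulrC divfK.
    by rewrite -mulrBr; apply/has_inverseM; split => //; exact: has_inverse_scalar.
  move=> /spectrum_shift hs; have [r r0 hr] := nG _ hs.
  have := spectrum_le NP cpl uni hs; rewrite hr normc_real ger0_norm // -/g => rg.
  exists (M * (g - r)); first by rewrite mulr_ge0 // subr_ge0.
  by rewrite rmorphM rmorphB /= -hr subKr mulrC divfK.
have ru r : spectrum u r%:C%C -> r ^+ 2 <= M * g.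
  move=> hr; have : spectrum (u ^+ 2) (r ^+ 2)%:C%C.
    by apply/spectrum_sqr; exists r%:C%C => //; rewrite rmorphXn.
  move=> hr2; have : spectrum ((M * g)%:C%C%:A - u ^+ 2) (M * g - r ^+ 2)%:C%C.
    by apply/spectrum_shift; rewrite rmorphB /= subKr.
  by move=> /nMG [s s0 /complexI]; lra.
pose q := Num.sqrt (M * g); have q2 : q ^+ 2 = M * g by rewrite sqr_sqrtr // mulr_ge0.
have q0 : 0 <= q by exact: sqrtr_ge0.
have qM : q < M.
  rewrite -(ltr_pXn2r (n := 2)) ?nnegrE // q2 expr2 ltr_pM2l //.
  exact: le_lt_trans gM.
pose d := M - q; have d0 : 0 < d by rewrite subr_gt0.
(* The spectrum of v lies in [d, +oo[, so that v^2 + j^2 >= d^2 > 0. *)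
pose v := M%:C%C%:A - u.
have Sv : S v by apply: SB.
have nv : nonneg_spectrum (v ^+ 2 - (d ^+ 2)%:C%C%:A).
  apply: (@nonneg_shift _ (d ^+ 2)) => //; last exact/Sreal/Ssq.
  move=> r /spectrum_sqr [m hm]; have [s sE] := Sreal Sv hm.
  rewrite sE -rmorphXn => /complexI ->.
  move: hm => /spectrum_shift; rewrite sE -rmorphB => /ru.
  rewrite -q2 -ler_sqrt ?sqr_ge0 // !sqrtr_sqr (ger0_norm q0) => h'.
  have := ler_norm (M - s) => h''.
  by rewrite lerXn2r ?nnegrE //; rewrite /d; lra.
have nvj : nonneg_spectrum (v ^+ 2 - (d ^+ 2)%:C%C%:A + j ^+ 2).
  apply: nonnegD => //; first exact/nonneg_sqr/Sreal.
  by apply: Sreal; apply: SD; [apply: SB => //|]; exact: Ssq.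
have : spectrum (v ^+ 2 - (d ^+ 2)%:C%C%:A + j ^+ 2) (- d ^+ 2)%:C%C.
  apply/spectrumE; rewrite rmorphN /= scaleNr -has_inverseN.
  have -> : - (- (d ^+ 2)%:C%C%:A - (v ^+ 2 - (d ^+ 2)%:C%C%:A + j ^+ 2)) = v ^+ 2 + j ^+ 2.
    by set w := (_ ^+ _)%:C%C%:A; ring.
  (* v^2 + j^2 = M ((x - h)^2 + (y - k)^2), and the last factor splits over I. *)
  have -> : v ^+ 2 + j ^+ 2 =
      M%:C%C%:A * ((X - h) - I * (Y - k)) * ((x +i* y)%C%:A - (h + 'i%C *: k)).
    rewrite (complexE (x +i* y)%C) /= scalerDl -scalerA -/Y -/X !IE.
    rewrite /v /j /u ME !XE !YE.
    by ring: I2.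
  by move=> /has_inverseM [_].
move=> /nvj [s s0 /complexI]; have : 0 < d ^+ 2 by rewrite exprn_gt0.
lra.
Qed.

Lemma norm_hermitian_le (h k : B) : S h -> S k ->
  N (h + 'i%C *: k) ^+ 2 <= N (h ^+ 2 + k ^+ 2).
Proof.
move=> Sh Sk; have [l hl <-] := spectral_point NP cpl uni (h + 'i%C *: k).
exact: spectrum_hermitian_le.
Qed.
End Hermitian.

Lemma norm_hermitian_le_alg (R : realType) (B : algType R[i]) (N : B -> R) (S : set B) :
  commutative (@GRing.mul B) ->
  p_normed_algebra 1 N -> complete_norm N -> uniform_norm N ->
  S 1 -> (forall x y, S x -> S y -> S (x + y)) ->
  (forall (r : R) x, S x -> S (r%:C%C *: x)) ->
  (forall x, S x -> S (x ^+ 2)) ->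
  (forall x, S x -> spectrum x `<=` [set alpha | alpha \is Num.real]) ->
  forall h k, S h -> S k -> N (h + 'i%C *: k) ^+ 2 <= N (h ^+ 2 + k ^+ 2).
Proof.
move=> mC NP cpl uni S1 SD SZ Ssq Sreal h k Sh Sk.
pose B' : comAlgType R[i] := HB.pack B (GRing.PzRing_hasCommutativeMul.Build B mC).
apply: (@norm_hermitian_le R B' N NP cpl uni S) => // x Sx l hl.
by exists (complex.Re l); rewrite RRe_real //; exact: Sreal hl.
Qed.

(** * Involutions *)

Section Star.
Variables (R : realType) (A : algType R[i]) (star : A -> A).
Hypothesis hstar : star_involution star.

Lemma starK a : star (star a) = a. Proof. by case: hstar. Qed.
Lemma starD a b : star (a + b) = star a + star b. Proof. by case: hstar. Qed.
Lemma starZ (l : R[i]) a : star (l *: a) = (l^*)%R *: star a. Proof. by case: hstar. Qed.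
Lemma starM a b : star (a * b) = star b * star a. Proof. by case: hstar. Qed.

Lemma star1 : star 1 = 1.
Proof. by rewrite -[LHS]mulr1 -{2}(starK 1) -starM mulr1 starK. Qed.

Lemma starB a b : star (a - b) = star a - star b.
Proof. by rewrite starD -scaleN1r starZ rmorphN1 scaleN1r. Qed.

Lemma star_cartesian a : exists h k,
  [/\ star h = h, star k = k & a = h + 'i%C *: k].
Proof.
have i2 : 'i%C * 'i%C = -1 :> R[i] by rewrite -expr2 sqr_i.
have ci : ('i%C^*)%R = - 'i%C :> R[i] by rewrite complexiE conjCi.
exists ((2^-1 : R[i]) *: (a + star a)), ((- 'i%C / 2 : R[i]) *: (a - star a)).
have c2 : ((2^-1 : R[i])^*)%R = 2^-1 by rewrite fmorphV rmorph_nat.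
split.
- by rewrite starZ starD starK addrC c2.
- rewrite starZ starB starK rmorphM rmorphN /= c2 ci opprK.
  by rewrite mulNr scaleNr -scalerN opprB.
rewrite scalerA mulNr mulrN mulrA i2 mulN1r opprK -scalerDr addrACA subrr addr0.
by rewrite -mulr2n -(scaler_nat 2 a) scalerA mulVf ?scale1r // pnatr_eq0.
Qed.
End Star.

(** * The involution of the completion *)

Section StarCompletion.
Variables (R : realType) (p : R) (hp0 : 0 < p).
Variables (A : algType R[i]) (nrmA : A -> R) (starA : A -> A).
Hypothesis hunif : uniform_norm nrmA.
Hypothesis hstar : star_involution starA.
Variables (B : algType R[i]) (nrmB : B -> R) (iota : {lrmorphism A -> B}).
Hypothesis hB : completion p nrmA nrmB iota.
Hypothesis hspec : forall h : A, self_adjoint starA h ->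
       spectrum (iota h) `<=` [set alpha | alpha \is Num.real].

Let nB : p_normed_algebra p nrmB. Proof. by case: hB. Qed.
Let cplB : complete_norm nrmB. Proof. by case: hB. Qed.
Let uniB : uniform_norm nrmB. Proof. exact: completion_uniform hB hunif. Qed.
Let mC : commutative (@GRing.mul B). Proof. exact: uniform_commutative hp0 nB uniB. Qed.

(** The self-adjoint elements of A embed in B as a real subspace closed under
    squares and consisting of elements with real spectrum. *)
Lemma star_sq_le a : nrmB (iota a) ^+ 2 <= nrmB (iota (starA a * a)).
Proof.
have [h [k [hh hk aE]]] := star_cartesian hstar a.
pose S : set B := [set iota h | h in self_adjoint starA].
have hN : nrmB (iota h + 'i%C *: iota k) `^ p^-1 ^+ 2 <=
          nrmB (iota h ^+ 2 + iota k ^+ 2) `^ p^-1.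
  apply: (@norm_hermitian_le_alg R B (fun b => nrmB b `^ p^-1) S) => //.
  - exact: root_norm_algebra.
  - exact: root_norm_complete.
  - exact: root_norm_uniform nB uniB.
  - by exists 1; [exact: star1|rewrite rmorph1].
  - move=> _ _ [x hx <-] [y hy <-]; exists (x + y); last by rewrite rmorphD.
    by rewrite /self_adjoint /= (starD hstar) hx hy.
  - move=> r _ [x hx <-]; exists (r%:C%C *: x); last by rewrite linearZ.
    by rewrite /self_adjoint /= (starZ hstar) hx conj_Creal // complex_real.
  - move=> _ [x hx <-]; exists (x ^+ 2); last by rewrite rmorphXn.
    by rewrite /self_adjoint /= expr2 (starM hstar) hx.
  - by move=> _ [x hx <-]; exact: hspec.
  - by exists h.
  - by exists k.
have -> : iota (starA a * a) = iota h ^+ 2 + iota k ^+ 2.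
  have ci : ('i%C^*)%R = - 'i%C :> R[i] by rewrite complexiE conjCi.
  rewrite aE (starD hstar) (starZ hstar) hh hk ci rmorphM !rmorphD /= !linearZ /=.
  rewrite mulrDl !mulrDr -!scalerAl -!scalerAr scalerA (mC (iota k) (iota h)).
  rewrite !scaleNr addrA addrK mulNr -(expr2 'i%C) sqr_i opprK scale1r.
  by rewrite -!expr2.
have -> : iota a = iota h + 'i%C *: iota k by rewrite aE rmorphD /= linearZ.
rewrite -(root_normK hp0 nB (_ + _)) -powRXn ?powR_ge0 //.
rewrite -(root_normK hp0 nB (iota h ^+ 2 + _)).
by apply: ge0_ler_powR; rewrite ?nnegrE ?exprn_ge0 ?powR_ge0 // ltW.
Qed.

(** From |a|^2 <= |a^* a| <= |a^*| |a| follows |a| <= |a^*|, for a^* as well as for a. *)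
Lemma star_isometry a : nrmB (iota (starA a)) = nrmB (iota a).
Proof.
have le b : nrmB (iota b) <= nrmB (iota (starA b)).
  have [-> |b0] := eqVneq (nrmB (iota b)) 0; first exact: pnorm_ge0 nB _.
  have bp : 0 < nrmB (iota b) by rewrite lt_neqAle eq_sym b0 (pnorm_ge0 nB).
  rewrite -(ler_pM2r bp) -expr2; apply: (le_trans (star_sq_le b)).
  by rewrite rmorphM; exact: pnormM nB _ _.
by apply/le_anti; rewrite le andbT -{2}(starK hstar a) le.
Qed.

Lemma cstar_identity a : nrmB (iota (starA a * a)) = nrmB (iota a) ^+ 2.
Proof.
apply/le_anti; rewrite star_sq_le andbT rmorphM.
by apply: (le_trans (pnormM nB _ _)); rewrite star_isometry expr2.
Qed.

Definition limit_of (u : nat -> A) (b : B) :=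
  (fun n => nrmB (iota (u n) - b)) @ \oo --> (0 : R).

(** An isometric involution maps Cauchy sequences to Cauchy sequences.  Asking for
    the property along every sequence converging to b, rather than along a chosen
    one, is what makes the algebraic identities pass to the limit. *)
Lemma starB_exists : exists starB : B -> B, forall u b,
  limit_of u b -> limit_of (starA \o u) (starB b).
Proof.
have /choice [sB hsB] : forall b, exists c, exists2 u, limit_of u b & limit_of (starA \o u) c.
  move=> b; have [u hu] := dense_seq hB b.
  have [|c hc] := cplB (u := fun n => iota (starA (u n))).
    move=> e e0; have e2 : 0 < e / 2 by rewrite divr_gt0.
    have [M _ hM] := cvgr0_norm_lt _ hu _ e2.
    exists ([set n | (M <= n)%N], [set n | (M <= n)%N]); first by split; exists M.
    move=> [m n] /= [/hM + /hM]; rewrite /= !ger0_norm ?(pnorm_ge0 nB) // => h1 h2.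
    rewrite -rmorphB -(starB hstar) star_isometry rmorphB.
    apply: (le_lt_trans (pdist_triangle nB b _ _)).
    rewrite [X in _ + X](pdistC nB); lra.
  by exists c, u.
exists sB => u b hu; have [u' hu' hc] := hsB b.
have h0 : (fun n => nrmB (iota (starA (u n - u' n)) - 0)) @ \oo --> (0 : R).
  have := pnorm_limD nB hu (pnorm_limZ nB (-1) hu').
  rewrite scaleN1r subrr; apply: cvg_trans; apply: near_eq_cvg; near=> n.
  by rewrite scaleN1r !subr0 -rmorphB star_isometry.
have := pnorm_limD nB h0 hc; rewrite add0r.
apply: cvg_trans; apply: near_eq_cvg; near=> n.
by rewrite /= (starB hstar) rmorphB subrK.
Unshelve. all: by end_near.
Qed.

Lemma limit_cst a : limit_of (fun=> a) (iota a).
Proof. by rewrite /limit_of subrr (pnorm0 hp0 nB); exact: cvg_cst. Qed.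

Lemma extension_cstar : exists2 starB : B -> B,
    unique (continuous_extension nrmB iota starA) starB &
    cstar_algebra (fun b => nrmB b `^ p^-1) starB.
Proof.
have [sB hsB] := starB_exists.
have dense := dense_seq hB.
have sBi a : sB (iota a) = iota (starA a).
  exact: (pnorm_lim_unique nB (hsB _ _ (limit_cst a)) (limit_cst (starA a))).
have sBD b c : sB (b + c) = sB b + sB c.
  have [u hu] := dense b; have [v hv] := dense c.
  have huv : limit_of (fun n => u n + v n) (b + c).
    move: (pnorm_limD nB hu hv); rewrite /limit_of.
    by under [X in _ -> X @ _ --> _]eq_fun do rewrite rmorphD.
  apply: (pnorm_lim_unique nB (hsB _ _ huv)).
  move: (pnorm_limD nB (hsB _ _ hu) (hsB _ _ hv)).
  by under [X in _ -> X @ _ --> _]eq_fun do rewrite /= (starD hstar) rmorphD.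
have sBZ (l : R[i]) b : sB (l *: b) = (l^*)%R *: sB b.
  have [u hu] := dense b.
  have hlu : limit_of (fun n => l *: u n) (l *: b).
    move: (pnorm_limZ nB l hu); rewrite /limit_of.
    by under [X in _ -> X @ _ --> _]eq_fun do rewrite linearZ.
  apply: (pnorm_lim_unique nB (hsB _ _ hlu)).
  move: (pnorm_limZ nB (l^*)%R (hsB _ _ hu)).
  by under [X in _ -> X @ _ --> _]eq_fun do rewrite /= (starZ hstar) linearZ.
have sBM b c : sB (b * c) = sB c * sB b.
  have [u hu] := dense b; have [v hv] := dense c.
  have huv : limit_of (fun n => u n * v n) (b * c).
    move: (pnorm_limM nB hu hv); rewrite /limit_of.
    by under [X in _ -> X @ _ --> _]eq_fun do rewrite rmorphM.
  apply: (pnorm_lim_unique nB (hsB _ _ huv)).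
  move: (pnorm_limM nB (hsB _ _ hv) (hsB _ _ hu)).
  by under [X in _ -> X @ _ --> _]eq_fun do rewrite /= (starM hstar) rmorphM.
have sBK b : sB (sB b) = b.
  have [u hu] := dense b.
  apply: (pnorm_lim_unique nB (hsB _ _ (hsB _ _ hu))).
  by under eq_fun do rewrite /= (starK hstar).
have sBn b : nrmB (sB b) = nrmB b.
  have [u hu] := dense b.
  have h1 := pnorm_cvg_norm nB (u := fun n => iota (u n)) hu.
  have h2 := pnorm_cvg_norm nB (u := fun n => iota (starA (u n))) (hsB _ _ hu).
  have h3 : (fun n => nrmB (iota (u n))) @ \oo --> nrmB (sB b).
    by move: h2; under eq_fun do rewrite star_isometry.
  exact: (cvg_unique (@Rhausdorff R) h3 h1).
have sBC b : nrmB (sB b * b) = nrmB b ^+ 2.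
  have [u hu] := dense b.
  have h1 := pnorm_cvg_norm nB (u := fun n => iota (u n)) hu.
  have h2 := pnorm_cvg_norm nB (pnorm_limM nB (u := fun n => iota (starA (u n))) (hsB _ _ hu) hu).
  have h3 : (fun n => nrmB (iota (u n)) ^+ 2) @ \oo --> nrmB (sB b * b).
    by move: h2; under eq_fun do rewrite -rmorphM cstar_identity.
  have h4 : (fun n => nrmB (iota (u n)) ^+ 2) @ \oo --> nrmB b ^+ 2.
    by under eq_fun do rewrite expr2; rewrite expr2; exact: cvgM.
  exact: (cvg_unique (@Rhausdorff R) h3 h4).
have sBB b c : sB (b - c) = sB b - sB c.
  by rewrite sBD -scaleN1r sBZ rmorphN1 scaleN1r.
exists sB.
  split; first split => // a e e0.
    by exists e => // b; rewrite -sBB sBn.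
  (* Uniqueness: two continuous maps that agree on a dense set are equal. *)
  move=> f [fc fi]; apply/funext => b; apply/eqP; rewrite -subr_eq0; apply/eqP.
  apply: (pnorm_eq0 nB); apply/eqP; rewrite eq_le (pnorm_ge0 nB) andbT.
  apply/ler_addgt0Pl => e e0; rewrite addr0.
  have e2 : 0 < e / 2 by rewrite divr_gt0.
  have [d d0 hd] := fc b _ e2.
  have dm : 0 < Num.min d (e / 2) by rewrite lt_min d0.
  have [_ _ _ den] := hB; have [a] := den b _ dm.
  rewrite (pdistC nB) lt_min => /andP[h1 h2].
  have := hd _ h1; rewrite fi => h3.
  have h4 : nrmB (sB b - iota (starA a)) < e / 2.
    by rewrite -sBi -sBB sBn (pdistC nB).
  apply: (le_trans (pdist_triangle nB (iota (starA a)) _ _)); lra.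
split.
- exact: root_norm_algebra.
- exact: root_norm_complete.
- by split.
- by move=> b; rewrite sBC powRXn // (pnorm_ge0 nB).
Qed.
End StarCompletion.

Theorem corollary4p6 (R : realType) (p : R) (hp0 : 0 < p) (hp1 : p <= 1)
    (A : algType R[i]) (nrmA : A -> R) (starA : A -> A)
    (hA : p_normed_algebra p nrmA)
    (hunif : uniform_norm nrmA)
    (hstar : star_involution starA)
    (B : algType R[i]) (nrmB : B -> R) (iota : {lrmorphism A -> B})
    (hB : completion p nrmA nrmB iota)
    (hspec : forall h : A, self_adjoint starA h ->
       spectrum (iota h) `<=` [set alpha | alpha \is Num.real]) :
  commutative (@GRing.mul B) /\
  exists2 starB : B -> B,
    unique (continuous_extension nrmB iota starA) starB &
    cstar_algebra (fun b => nrmB b `^ p^-1) starB.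
Proof.
split; last exact: (extension_cstar hp0 hunif hstar hB hspec).
have [nB _ _ _] := hB.
exact: (uniform_commutative hp0 nB (completion_uniform hB hunif)).
Qed.
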